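(* Let $k\in\mathbb N$, $k\ge1$. Every ergodic central measure on the space of infinite paths in the subgraph $\mathbb Y_k$ of the Young graph consisting of the diagrams with at most $k$ rows is a Thoma measure $\mathcal M_{(p,0,0)}$ for some $p=(p_1,\dots,p_k)$ with $p_1\ge\dots\ge p_k\ge0$ and $p_1+\dots+p_k=1$.
   Context: The Young graph $\mathbb Y$ is the graded graph whose vertices of level $n$ are the Young diagrams with $n$ cells, with an edge from $\lambda$ to $\mu$ when $\mu$ is obtained from $\lambda$ by adding one cell. $\mathbb Y_k$ is the subgraph spanned by diagrams with at most $k$ rows. $\dim\lambda$ is the number of paths from $\emptyset$ to $\lambda$. The set of infinite paths starting at $\emptyset$ is given its natural product Borel structure, and $C_\lambda$ is the set of infinite paths passing through $\lambda$. A Borel probability measure on the infinite path space of a graded graph is central if for every vertex $v$ of any level $n$ with positive probability of being visited, conditionally on passing through $v$ at level $n$ and on the path after level $n$, all finite paths from $\emptyset$ to $v$ are equally probable. A central measure is ergodic if every Borel set that is a union of classes of the tail equivalence relation (two paths are equivalent if they coincide from some level on) has measure $0$ or $1$; equivalently, it is an extreme point of the set of central measures. The Thoma measure $\mathcal M_{(p,0,0)}$ is the central measure determined by $\mathcal M_{(p,0,0)}(C_\lambda)=\dim\lambda\cdot s_\lambda(p_1,\dots,p_k)$ for all $\lambda$, where $s_\lambda$ is the Schur function $s_\lambda(p)=\sum_S\prod_i p_i^{m_i(S)}$, the sum being over semistandard Young tableaux $S$ of shape $\lambda$ with entries in $\{1,\dots,k\}$ and $m_i(S)$ being the number of occurrences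 of $i$ in $S$. *)

(* Defs.v *)
From HB Require Import structures.
From mathcomp Require Import all_boot all_order all_algebra.
From mathcomp Require Import finmap.
From mathcomp Require Import all_classical all_reals all_analysis.

Set Implicit Arguments.
Unset Strict Implicit.
Unset Printing Implicit Defensive.
Import Order.TTheory GRing.Theory Num.Theory.

Local Open Scope classical_set_scope.
Local Open Scope ring_scope.

(* The condition [edge_out] (no dead ends) makes the infinite path space
   nonempty, as MathComp-Analysis requires of a measurable type. *)
Record gradedGraph := GradedGraph {
  vertex :> countType;
  level : vertex -> nat;
  edge : rel vertex;
  source : vertex;
  level_source : level source = 0%N;
  edge_level : forall u v, edge u v -> level v = (level u).+1;
  finite_level : forall n, finite_set [set v | level v = n];
  edge_out : forall v, exists u, edge v u
}.
Arguments source : clear implicits.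

Section Subgraph.
Variables (G : gradedGraph) (D : pred G).
Hypothesis D_source : D (source G).
Hypothesis D_out : forall v, D v -> exists2 u, D u & edge v u.

Let V := {v : G | D v}.

Fact subgraph_edge_level (u v : V) :
  edge (val u) (val v) -> level (val v) = (level (val u)).+1.
Proof. exact: edge_level. Qed.

Fact subgraph_finite_level n : finite_set [set v : V | level (val v) = n].
Proof.
apply: (@finite_preimage _ _ [set v : G | level v = n] val).
  by move=> u v _ _; exact: val_inj.
exact: finite_level.
Qed.

Fact subgraph_edge_out (v : V) : exists u : V, edge (val v) (val u).
Proof. by have [u Du vu] := D_out (valP v); exists (exist _ u Du). Qed.

Definition subgraph : gradedGraph :=
  @GradedGraph V (fun v => level (val v)) (fun u v => edge (val u) (val v))
    (exist _ (source G) D_source) (level_source G)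
    subgraph_edge_level subgraph_finite_level subgraph_edge_out.

End Subgraph.

Section Paths.
Variable G : gradedGraph.

(* The source is left out of the sequence. *)
Definition finpaths (v : G) : set (seq G) :=
  [set p | path (@edge G) (source G) p /\ last (source G) p = v].

Fact size_finpath (v : G) p : finpaths v p -> size p = level v.
Proof.
move=> [+ <-]; rewrite -[RHS]subn0 -(level_source G).
suff H x : path (@edge G) x p -> level (last x p) = (level x + size p)%N.
  by move=> /H ->; rewrite addKn.
elim: p x => [|y p IH] x /=; first by rewrite addn0.
by case/andP => /edge_level xy /IH ->; rewrite xy addSnnS.
Qed.

Fact finite_finpaths (v : G) : finite_set (finpaths v).
Proof.
have [n] := ubnP (level v); elim: n v => // n IH v; rewrite ltnS => vn.
pose A := [set u : G | edge u v].
have finA : finite_set A.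
  apply: (@sub_finite_set _ _ [set u | level u = (level v).-1]).
    by move=> u /edge_level ->.
  exact: finite_level.
have finB : finite_set (\bigcup_(u in A) [set rcons p v | p in finpaths u]).
  apply: bigcup_finite => // u /edge_level uv.
  by apply/finite_image/IH; rewrite -uv.
apply: (@sub_finite_set _ _ ([set [::]] `|` \bigcup_(u in A)
    [set rcons p v | p in finpaths u])); last first.
  by rewrite finite_setU; split => //; exact: finite_set1.
move=> p [/= pp pv]; case/lastP: p pp pv => [|p u]; first by left.
rewrite rcons_path last_rcons => /andP[pp pu] uv; right.
by rewrite -uv; exists (last (source G) p); [rewrite /A/= -uv|exists p].
Qed.

Definition pathdim (v : G) : nat := #|` fset_set (finpaths v)|%fset.

Record infpath := Infpath {
  infpath_fun :> nat -> G;
  infpath0 : infpath_fun 0%N = source G;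
  infpathS : forall n, edge (infpath_fun n) (infpath_fun n.+1)
}.

HB.instance Definition _ := gen_eqMixin infpath.
HB.instance Definition _ := gen_choiceMixin infpath.

Let out (v : G) : G := xchoose (edge_out v).

Definition infpath_pt : infpath :=
  @Infpath (fun n => iter n out (source G)) erefl
    (fun n => xchooseP (edge_out _)).

HB.instance Definition _ := isPointed.Build infpath infpath_pt.

(* The events [t m \in B] with n <= m and B an arbitrary set of vertices. *)
Definition coord_events (n : nat) : set (set infpath) :=
  \bigcup_(m in [set m | (n <= m)%N])
    preimage_set_system setT (fun t : infpath => t m) setT.

Definition future_events (n : nat) : set (set infpath) :=
  <<s coord_events n >>.

Definition cylinder (v : G) : set infpath := [set t | t (level v) = v].

Definition initial (p : seq G) : set infpath :=
  [set t | mkseq (fun i => t i.+1) (size p) = p].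

Definition tail_equiv (s t : infpath) : Prop :=
  exists n, forall m, (n <= m)%N -> s m = t m.

End Paths.
Arguments coord_events : clear implicits.
Arguments future_events : clear implicits.

(* The vertex set being countable and discrete, this is the trace on infinite
   paths of the Borel sigma-algebra of the product topology. *)
Notation path_space G := (g_sigma_algebraType (coord_events G 0)).

Section Conditional.
Context d (T : measurableType d) (R : realType).
Local Open Scope ereal_scope.

(* [f] is a version of the conditional probability of A given the
   sub-sigma-algebra F. *)
Definition cond_prob (P : probability T R) (F : set (set T)) (A : set T)
    (f : T -> R) : Prop :=
  [/\ forall B : set R, measurable B -> F (f @^-1` B),
      P.-integrable setT (EFin \o f) &
      forall B, F B -> \int[P]_(t in B) (f t)%:E = P (A `&` B)].

End Conditional.

Section Central.
Variables (G : gradedGraph) (R : realType).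
Local Open Scope ereal_scope.

(* Conditioning on [future_events G (level v)] includes conditioning on the
   passage through v, as [cylinder v] belongs to that sigma-algebra. *)
Definition central (P : probability (path_space G) R) : Prop :=
  forall v : G, 0 < P (cylinder v) ->
  exists f, forall p, finpaths v p ->
    cond_prob P (future_events G (level v)) (initial p) f.

Definition ergodic (P : probability (path_space G) R) : Prop :=
  forall A : set (path_space G), measurable A ->
    (forall s t : infpath G, tail_equiv s t -> A s -> A t) ->
    P A = 0 \/ P A = 1.

End Central.

(* Row lengths, from top to bottom. *)
Record diagram := Diagram {
  rows :> seq nat;
  rowsP : sorted geq rows && (0%N \notin rows)
}.

HB.instance Definition _ := [isSub for rows].
HB.instance Definition _ := [Countable of diagram by <:].

Definition add_cell (la mu : diagram) : bool :=
  [exists i : 'I_(size la).+1, rows mu == incr_nth la i].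

Definition empty_diagram : diagram := @Diagram [::] isT.

Fact add_cell_level (la mu : diagram) :
  add_cell la mu -> sumn mu = (sumn la).+1.
Proof.
case/existsP => -[i _] /eqP -> /=.
elim: i (rows la) => [|i IH] [|x s] //=; last by rewrite IH addnS.
by rewrite sumn_ncons /= mul0n.
Qed.

Fact finite_diagrams n : finite_set [set la : diagram | sumn la = n].
Proof.
pose g (t : n.-tuple 'I_n.+1) : diagram :=
  insubd empty_diagram [seq i <- map val t | i != 0%N].
apply: (@sub_finite_set _ _ [set g t | t in setT]); last first.
  exact/finite_image/finite_finset.
move=> la /= lan; have [_ la0] := andP (rowsP la).
have le_size : (size la <= n)%N.
  rewrite -lan; elim: (rows la) la0 => //= x s IH.
  by rewrite inE negb_or eq_sym -lt0n => /andP[x0 /IH]; rewrite -add1n; exact: leq_add.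
have le_row x : x \in rows la -> (x < n.+1)%N.
  rewrite ltnS -lan => xs; rewrite (perm_sumn (perm_to_rem xs)) /=.
  exact: leq_addr.
have szP : size (map (@inord n) la ++ nseq (n - size la) ord0) == n.
  by rewrite size_cat size_map size_nseq subnKC.
exists (Tuple szP) => //; apply: val_inj.
rewrite /g /= map_cat filter_cat map_nseq filter_nseq /= cats0.
have -> : map val (map (@inord n) la) = rows la.
  rewrite -map_comp -[RHS]map_id; apply/eq_in_map => x /le_row xn /=.
  by rewrite inordK.
have -> : [seq i <- rows la | i != 0%N] = rows la.
  by apply/all_filterP/allP => x xs; apply: contraNneq la0 => <-.
by rewrite val_insubd rowsP.
Qed.

Fact add_cell0_subproof (la : diagram) :
  sorted geq (incr_nth la 0) && (0%N \notin incr_nth la 0).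
Proof.
case: la => -[|x [|y s]] //= /andP[/andP[yx ->]].
by rewrite !inE !negb_or /= andbT (leq_trans yx) //= => /and3P[_ -> ->].
Qed.

Definition add_cell0 (la : diagram) : diagram := Diagram (add_cell0_subproof la).

Fact add_cell0P la : add_cell la (add_cell0 la).
Proof. by apply/existsP; exists ord0. Qed.

Fact young_out (la : diagram) : exists mu, add_cell la mu.
Proof. by exists (add_cell0 la); exact: add_cell0P. Qed.

Definition young : gradedGraph :=
  @GradedGraph diagram (fun la => sumn la) add_cell empty_diagram erefl
    add_cell_level finite_diagrams young_out.

Section YoungRows.
Variables (k : nat) (k_gt0 : (0 < k)%N).

Fact young_rows_out (la : young) : (size (rows la) <= k)%N ->
  exists2 mu : young, (size (rows mu) <= k)%N & edge la mu.
Proof.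
move=> lak; exists (add_cell0 la); last exact: add_cell0P.
by rewrite size_incr_nth; case: ifP.
Qed.

Definition young_rows : gradedGraph :=
  @subgraph young (fun la => size (rows la) <= k)%N (leq0n k) young_rows_out.

Fact young_rows_inclusion0 (t : infpath young_rows) : val (t 0%N) = source young.
Proof. by rewrite infpath0. Qed.

Fact young_rows_inclusionS (t : infpath young_rows) n :
  @edge young (val (t n)) (val (t n.+1)).
Proof. exact: (infpathS t n). Qed.

Definition young_rows_inclusion (t : path_space young_rows) :
    path_space young :=
  @Infpath young (fun n => val (t n)) (young_rows_inclusion0 t)
    (young_rows_inclusionS t).

Fact measurable_young_rows_inclusion :
  measurable_fun setT young_rows_inclusion.
Proof.
apply: (@measurability _ _ (path_space young_rows) (path_space young) setT
  young_rows_inclusion (coord_events young 0) erefl) => _ [_ [m m0 [B _ <-]] <-].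
rewrite !setTI.
apply: sub_sigma_algebra; exists m => //.
by exists (val @^-1` B) => //; rewrite setTI.
Qed.

HB.instance Definition _ := isMeasurableFun.Build _ _ _ _
  young_rows_inclusion measurable_young_rows_inclusion.

End YoungRows.

Section Schur.
Variables (la : diagram) (k : nat).

Definition cell : finType := {i : 'I_(size la) & 'I_(nth 0%N la i)}.
Definition cell_row (c : cell) : nat := tag c.
Definition cell_col (c : cell) : nat := tagged c.

Definition semistandard (S : {ffun cell -> 'I_k}) : bool :=
  [forall c, forall c',
     ((cell_row c == cell_row c') && (cell_col c < cell_col c')%N
        ==> (S c <= S c')%N) &&
     ((cell_col c == cell_col c') && (cell_row c < cell_row c')%N
        ==> (S c < S c')%N)].

Definition schur (R : realType) (p : 'I_k -> R) : R :=
  \sum_(S : {ffun cell -> 'I_k} | semistandard S)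
    \prod_(i < k) p i ^+ #|[pred c | S c == i]|.

End Schur.

(* M is the Thoma measure with parameters (p, 0, 0). *)
Definition thoma (R : realType) (k : nat) (p : 'I_k -> R)
    (M : probability (path_space young) R) : Prop :=
  central M /\
  forall la : young,
    M (cylinder la) = ((pathdim la)%:R * schur la p)%:E.

(* Main.v *)
Require Import Defs.
From HB Require Import structures.
From mathcomp Require Import all_boot all_order all_algebra.
From mathcomp Require Import perm finmap.
From mathcomp Require Import all_classical all_reals all_analysis.
From mathcomp Require Import measurable_realfun.
From mathcomp Require Import zify ring.

Set Implicit Arguments.
Unset Strict Implicit.
Unset Printing Implicit Defensive.
Import Order.TTheory GRing.Theory Num.Theory.
Import numFieldNormedType.Exports.

Local Open Scope classical_set_scope.
Local Open Scope ring_scope.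

(** Let c_v be the probability that the random path passes through v. A central
    measure makes the conditional probability of this passage, given the future
    from level n on, a function of the vertex w at level n: the proportion
    dim v dim(v, w) / dim w of the paths to w that pass through v, where dim v
    counts the paths to v and dim(v, w) those from v to w ([central_npath]). For increasing n these conditional probabilities form a
    reversed martingale. Its second moments decrease, so that it converges
    almost surely along a sequence of levels; the limit is measurable for the
    tail events, hence constant by ergodicity and equal to c_v
    ([zero_one_cvg]). Averaging over the vertices of one high level then gives
    vertices w for which these proportions are as close as wanted to c_v, for
    any finite set of vertices v at once ([cprob_approx]).

    For diagrams with at most k rows the proportions are computed exactly. The
    number dim(v, w) is, up to a factorial, the determinant of the
    1 / (l_i - a_j)!, where l and a are the row lengths of w and v shifted by
    k - 1, ..., 0, because this determinant obeys the recursion over the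
    predecessors of w ([npath_skewdet]). The ratio dim(v, w) / dim w thus is a
    quotient of alternants of falling factorials, that is, a factorial Schur
    function of l, and after division of the variables by n it is, up to a
    factor tending to 1, the factorial Schur function with the parameter 1 / n
    instead of 1 ([npath_fschur]). Factorial Schur functions are defined here
    by a branching rule in the number of variables which involves neither
    division nor signs; the bialternant formula is a theorem ([det_altmx]).
    Two facts are then immediate by induction on the number of variables: they
    are continuous in the parameter and the variables ([cvg_fschur]), and at
    the parameter 0 they are the sums over semistandard tableaux, a tableau
    being peeled off its largest entry ([tabsum_fschur]).

    The row lengths of the chosen vertices w divided by their levels lie in a
    compact set. Along an ultrafilter they converge to some p, and the
    ratio dim(v, w) / dim w converges both to c_v / dim v and to
    s_v(p). *)

(** * Factorial Schur functions *)

Section FactorialPower.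
Variables (R : comNzRingType) (th : R).

(** The product x (x - th) (x - 2 th) ... with a factors: the power x ^+ a
    for th = 0, the falling factorial for th = 1. *)
Definition ffpow (a : nat) (x : R) : R := \prod_(0 <= s < a) (x - s%:R * th).

Lemma ffpow0 x : ffpow 0 x = 1.
Proof. by rewrite /ffpow big_geq. Qed.

Lemma ffpowS a x : ffpow a.+1 x = ffpow a x * (x - a%:R * th).
Proof. by rewrite /ffpow big_nat_recr. Qed.

(** Telescoping expansion of the divided difference of the polynomial
    ffpow a / ffpow b. *)
Lemma ffpow_telescope a b x y : (b <= a)%N ->
  ffpow a x - (\prod_(b <= s < a) (y - s%:R * th)) * ffpow b x =
  (x - y) * \sum_(b <= c < a)
     ffpow c x * \prod_(c.+1 <= s < a) (y - s%:R * th).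
Proof.
move=> /subnK <-; elim: (a - b)%N => {a} [|d IH].
  by rewrite add0n !big_geq // mul1r subrr mulr0.
set a := (d + b)%N in IH *; have ba : (b <= a)%N by rewrite leq_addl.
rewrite addSn -/a ffpowS. rewrite [\prod_(b <= s < a.+1) _]big_nat_recr //=.
rewrite [\sum_(b <= c < a.+1) _]big_nat_recr //=.
rewrite [\prod_(a.+1 <= s < a.+1) _]big_geq // mulr1.
have -> : \sum_(b <= c < a) ffpow c x * \prod_(c.+1 <= s < a.+1) (y - s%:R * th)
    = \sum_(b <= c < a) (ffpow c x * \prod_(c.+1 <= s < a) (y - s%:R * th)) *
        (y - a%:R * th).
  by apply: eq_big_nat => c /andP[_ ca]; rewrite big_nat_recr //= mulrA.
rewrite -mulr_suml [RHS]mulrDr [X in _ = X + _]mulrA -IH; ring.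
Qed.

End FactorialPower.

(** The finite sequence m prolonged by zeros. *)
Definition natf (n N : nat) (m : {ffun 'I_n -> 'I_N}) (j : nat) : nat :=
  if insub j is Some i then m i else 0%N.

Lemma natfE n N (m : {ffun 'I_n -> 'I_N}) (i : 'I_n) : natf m i = m i.
Proof. by rewrite /natf valK. Qed.

Lemma natf_ge n N (m : {ffun 'I_n -> 'I_N}) j : (n <= j)%N -> natf m j = 0%N.
Proof. by move=> nj; rewrite /natf insubF // ltnNge nj. Qed.

(** The sequence m interlaces la: la_0 >= m_0 >= la_1 >= m_1 >= ... *)
Definition interlace (la : nat -> nat) n N (m : {ffun 'I_n -> 'I_N}) : bool :=
  [forall j : 'I_n, (la j.+1 <= m j <= la j)%N].

Lemma interlaceP la n N (m : {ffun 'I_n -> 'I_N}) :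
  reflect (forall j, (j < n)%N -> (la j.+1 <= natf m j <= la j)%N)
          (interlace la m).
Proof.
apply: (iffP forallP) => [h j jn|h j]; last by rewrite -natfE h.
by rewrite -[j]/(nat_of_ord (Ordinal jn)) natfE h.
Qed.

(** The row lengths la_0, ..., la_(k-1) weakly decrease and are less than N. *)
Definition row_shape (k N : nat) (la : nat -> nat) : Prop :=
  (forall j, (j.+1 < k)%N -> la j.+1 <= la j)%N /\
  (forall j, j < k -> la j < N)%N.

Lemma shape_interlace k N la (m : {ffun 'I_k -> 'I_N}) :
  row_shape k.+1 N la -> interlace la m -> row_shape k N (natf m).
Proof.
move=> _ /interlaceP h; split=> j jk.
  have /andP[_ h1] := h _ jk; have /andP[h2 _] := h _ (ltnW jk).
  exact: leq_trans h1 h2.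
by rewrite -[j]/(nat_of_ord (Ordinal jk)) natfE.
Qed.

Section FactorialSchur.
Variables (R : comNzRingType) (N : nat) (th : R).

(** The factorial Schur function of the shape la in k variables, defined by
    its branching rule; at th = 0 it is the Schur function. The bound N on the
    parts only serves to make the sum finite. *)
Fixpoint fschur (k : nat) (la : nat -> nat) (x : nat -> R) : R :=
  if k is n.+1 then
    ffpow th (la n) (x n) *
    \sum_(m : {ffun 'I_n -> 'I_N} | interlace la m)
      (\prod_(j < n) \prod_((m j + (n - j.+1)).+1 <= s < la j + (n - j))
          (x n - s%:R * th)) * fschur n (natf m) x
  else 1.

(** The Vandermonde determinant in the variables x_0, ..., x_(k-1). *)
Definition vander (k : nat) (x : nat -> R) : R :=
  \prod_(j < k) \prod_(i < j) (x i - x j).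

Lemma vanderS k x : vander k.+1 x = vander k x * \prod_(i < k) (x i - x k).
Proof. by rewrite /vander big_ord_recr. Qed.

(** The alternant whose columns have the strictly decreasing degrees
    la_j + k - 1 - j. *)
Definition altmx (k : nat) (la : nat -> nat) (x : nat -> R) : 'M[R]_k :=
  \matrix_(i, j) ffpow th (la j + (k - j.+1)) (x i).

(** A determinant is multilinear in its columns. *)
Lemma det_sum_col n (I : finType) (Q : 'I_n -> pred I)
    (F : 'I_n -> 'I_n -> I -> R) :
  \det (\matrix_(i, j) \sum_(c | Q j c) F i j c) =
  \sum_(m : {ffun 'I_n -> I} | m \in family Q)
     \det (\matrix_(i, j) F i j (m j)).
Proof.
rewrite -det_tr [LHS]/determinant.
under [RHS]eq_bigr => m _ do rewrite -det_tr /determinant.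
rewrite exchange_big /=; apply: eq_bigr => s _; rewrite -mulr_sumr;
  congr (_ * _).
under eq_bigr => i _ do rewrite !mxE.
rewrite (bigA_distr_big_dep Q (fun j c => F (s j) j c)) /=.
by apply: eq_bigr => m _; apply: eq_bigr => i _; rewrite !mxE.
Qed.

Lemma det_scale_row n (d : 'I_n -> R) (A : 'I_n -> 'I_n -> R) :
  \det (\matrix_(i, j) (d i * A i j)) =
  (\prod_i d i) * \det (\matrix_(i, j) A i j).
Proof.
rewrite /determinant mulr_sumr; apply: eq_bigr => s _.
rewrite mulrCA -big_split /=; congr (_ * _).
by apply: eq_bigr => i _; rewrite !mxE.
Qed.

Lemma det_scale_col n (d : 'I_n -> R) (A : 'I_n -> 'I_n -> R) :
  \det (\matrix_(i, j) (d j * A i j)) =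
  (\prod_i d i) * \det (\matrix_(i, j) A i j).
Proof.
rewrite -det_tr -[\det (\matrix_(i, j) A i j)]det_tr.
have -> : (\matrix_(i, j) A i j)^T = \matrix_(i, j) A j i.
  by apply/matrixP => i j; rewrite !mxE.
rewrite -(det_scale_row d (fun i j => A j i)).
by congr (\det _); apply/matrixP => i j; rewrite !mxE.
Qed.

(** Subtracting from each column a multiple of the next one does not change
    the determinant. *)
Lemma det_colops n (A : 'M[R]_n.+1) (g : nat -> R) :
  \det A = \det (\matrix_(i, j) (A i j -
     if (j < n)%N then g j * A i (inord j.+1) else 0)).
Proof.
pose U : 'M[R]_n.+1 := \matrix_(i, j)
   ((i == j)%:R - (if (i == j.+1 :> nat) then g j else 0)).
have detU : \det U = 1.
  rewrite det_trig; last first.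
    apply/is_trig_mxP => i j ij; rewrite mxE (ltn_eqF (ltnW _)) // subr0.
    by rewrite -val_eqE /= ltn_eqF.
  apply: big1 => i _; rewrite mxE eqxx (ltn_eqF (ltnSn _)).
  by rewrite subr0.
rewrite -[LHS]mulr1 -detU -det_mulmx; congr (\det _).
apply/matrixP => i j; rewrite !mxE.
under eq_bigr => l _ do rewrite !mxE mulrBr.
rewrite sumrB (bigD1 j) //= eqxx mulr1 big1 ?addr0; last first.
  by move=> l /negPf ->; rewrite mulr0.
congr (_ - _); case: ltnP => jn; last first.
  apply: big1 => l _; rewrite ltn_eqF ?mulr0 //.
  exact: leq_trans (ltn_ord l) _.
rewrite (bigD1 (inord j.+1)) // inordK // eqxx mulrC big1 /= ?addr0 // => l lj.
rewrite ifN ?mulr0 //; apply: contra lj => /eqP lj; apply/eqP/val_inj.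
by rewrite /= inordK.
Qed.

(** Jacobi's bialternant formula, for factorial powers. Column operations make
    all entries of the row of x_(k-1) vanish but the last; by
    [ffpow_telescope], the entries of the remaining minor are x_i - x_(k-1)
    times sums, over the parts allowed by interlacing, of multiples of entries
    of alternants of order k - 1. *)
Theorem det_altmx k la x : row_shape k N la ->
  \det (altmx k la x) = vander k x * fschur k la x.
Proof.
elim: k la => [|n IH] la sh; first by rewrite det_mx00 /vander big_ord0 mul1r.
pose a j := (la j + (n - j))%N; pose y := x n.
pose g j := \prod_(a j.+1 <= s < a j) (y - s%:R * th).
have sla j : (j < n)%N -> (a j.+1 < a j)%N.
  move=> jn; rewrite /a -addnS -subSn // subSS leq_add2r.
  exact: sh.1.
have aE : altmx n.+1 la x = \matrix_(i, j) ffpow th (a j) (x i).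
  by apply/matrixP => i j; rewrite !mxE.
rewrite aE (det_colops _ g).
set B := (X in \det X).
pose w j c := \prod_(c.+1 <= s < a j) (y - s%:R * th).
have BE (i j : 'I_n.+1) : (j < n)%N -> B i j = (x i - y) *
    \sum_(a j.+1 <= c < a j) ffpow th c (x i) * w j c.
  by move=> jn; rewrite !mxE jn inordK // /g /w -ffpow_telescope // ltnW ?sla.
rewrite (expand_det_row _ ord_max) big_ord_recr /= big1 ?add0r; last first.
  by move=> j _; rewrite BE //= subrr !mul0r.
rewrite /cofactor -signr_odd oddD addbb mul1r.
have -> : B ord_max ord_max = ffpow th (la n) y.
  by rewrite !mxE /= ltnn subr0 /a subnn addn0.
rewrite vanderS -/y; set pr := \prod_(i < n) _.
suff : \det (row' ord_max (col' ord_max B)) = pr *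
   \sum_(m : {ffun 'I_n -> 'I_N} | interlace la m)
      (\prod_(j < n) \prod_((m j + (n - j.+1)).+1 <= s < la j + (n - j))
          (y - s%:R * th)) * (vander n x * fschur n (natf m) x).
  move=> ->; have -> (I : finType) (Q : pred I) (F H : I -> R) :
      \sum_(m | Q m) F m * (vander n x * H m) =
      vander n x * \sum_(m | Q m) F m * H m.
    by rewrite mulr_sumr; apply: eq_bigr => m _; rewrite mulrCA.
  by rewrite /=; ring.
have lE (j : 'I_n) : lift ord_max j = j :> nat.
  by rewrite /= /bump leqNgt ltn_ord.
transitivity (\det (\matrix_(i < n, j < n) ((x i - y) *
    \sum_(c < N | (la j.+1 <= c <= la j)%N)
      ffpow th (c + (n - j.+1)) (x i) * w j (c + (n - j.+1))%N))).
  congr (\det _); apply/matrixP => i j; rewrite mxE [LHS]mxE.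
  rewrite BE ?lE // mxE; congr (_ * _).
  have aE1 : a j = ((la j).+1 + (n - j.+1))%N.
    by rewrite /a addSnnS -subSn ?subSS // ltn_ord.
  rewrite [in LHS]aE1 [a _]/(la j.+1 + (n - j.+1))%N big_addn addnK.
  rewrite (big_nat_widenl _ 0) // (big_nat_widen _ _ N); last first.
    by apply: sh.2; rewrite ltnW // ltnS ltn_ord.
  rewrite big_mkord; apply: eq_bigl => c /=.
  by rewrite ltnS andbC.
rewrite det_scale_row -/pr; congr (_ * _).
rewrite (det_sum_col (fun (j : 'I_n) (c : 'I_N) => la j.+1 <= c <= la j)%N) /=.
apply: eq_big => m.
  by apply/familyP/forallP => h j; have := h j; rewrite unfold_in.
move=> mQ; have lm : interlace la m.
  by apply/forallP => j; have := familyP mQ j; rewrite unfold_in.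
rewrite -(IH _ (shape_interlace sh lm)).
under eq_mx do rewrite mulrC.
rewrite det_scale_col; congr (_ * \det _).
by apply/matrixP => i j; rewrite !mxE natfE.
Qed.

End FactorialSchur.

Lemma eq_fschur (R : comNzRingType) N (th : R) k la (x y : nat -> R) :
  (forall j, (j < k)%N -> x j = y j) -> fschur N th k la x = fschur N th k la y.
Proof.
elim: k la => [|n IH] la xy //=; rewrite xy //; congr (_ * _).
apply: eq_bigr => m _; congr (_ * _); apply: IH => j jn.
by apply: xy; exact: ltnW.
Qed.

Lemma fschur_empty (R : comNzRingType) N (th : R) k x :
  (0 < N)%N -> fschur N th k (fun=> 0%N) x = 1.
Proof.
case: N => // N' _; elim: k x => [|n IH] x //=.
rewrite ffpow0 mul1r (big_pred1 [ffun=> ord0]) => [|m]; last first.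
  apply/forallP/eqP => [h|-> j]; last by rewrite ffunE.
  by apply/ffunP => j; apply/val_inj; rewrite ffunE; have := h j;
    case: (m j) => [[]].
rewrite big1 => [|j _]; last first.
  by rewrite ffunE !add0n -subSn // subSS big_geq.
rewrite mul1r -[RHS](IH x); congr fschur; apply/funext => j.
by rewrite /natf; case: insub => // i; rewrite ffunE.
Qed.

Section Limit.
Variables (R : realType) (T : Type) (F : set_system T).
Context {FF : Filter F}.

Lemma cvg_bigprod (I : Type) (r : seq I) (Q : pred I) (f : I -> T -> R)
    (l : I -> R) :
  (forall i, Q i -> f i @ F --> l i) ->
  (fun t => \prod_(i <- r | Q i) f i t) @ F --> \prod_(i <- r | Q i) l i.
Proof. by apply: cvg_big => -[a b]; exact: mul_continuous. Qed.

Lemma cvg_bigsum (I : Type) (r : seq I) (Q : pred I) (f : I -> T -> R)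
    (l : I -> R) :
  (forall i, Q i -> f i @ F --> l i) ->
  (fun t => \sum_(i <- r | Q i) f i t) @ F --> \sum_(i <- r | Q i) l i.
Proof. by apply: cvg_big => -[a b]; exact: add_continuous. Qed.

Lemma cvg_ffpow a (th x : T -> R) (th0 x0 : R) :
  th @ F --> th0 -> x @ F --> x0 ->
  (fun t => ffpow (th t) a (x t)) @ F --> ffpow th0 a x0.
Proof.
move=> hth hx; apply: cvg_bigprod => s _.
by apply: cvgB => //; apply: cvgM => //; exact: cvg_cst.
Qed.

(** Factorial Schur functions depend continuously on the parameter and on
    the variables. *)
Lemma cvg_fschur N k la (th : T -> R) (x : T -> nat -> R)
    (th0 : R) (x0 : nat -> R) :
  th @ F --> th0 -> (forall j, (j < k)%N -> x^~ j @ F --> x0 j) ->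
  (fun t => fschur N (th t) k la (x t)) @ F --> fschur N th0 k la x0.
Proof.
move=> hth; elim: k la => [|n IH] la hx /=; first exact: cvg_cst.
apply: cvgM; first by apply: cvg_ffpow => //; exact: hx.
apply: cvg_bigsum => m _; apply: cvgM; last by apply: IH => j jn; apply/hx/ltnW.
apply: cvg_bigprod => j _; apply: cvg_bigprod => s _.
by apply: cvgB; [exact: hx|apply: cvgM => //; exact: cvg_cst].
Qed.

End Limit.

(** * Semistandard tableaux and the branching rule *)

Section Tableaux.
Variables (K' N' : nat).
Local Notation K := K'.+1.
Local Notation N := N'.+1.
Local Notation box := ('I_K * 'I_N)%type.
Local Notation filling := {ffun box -> 'I_K.+1}.

Implicit Types (la : nat -> nat) (S : filling) (x y : box).

(** The cell x lies in the shape with row lengths la. *)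
Definition inside la x : bool := (x.2 < la x.1)%N.

(** A semistandard tableau of shape la with entries less than k, extended by
    the value k to the cells of the rectangle 'I_K * 'I_N outside la. *)
Definition ssyt (k : nat) la S : bool :=
  [forall x : box, if inside la x then (S x < k)%N else S x == k :> nat] &&
  [forall x : box, forall y : box, inside la x ==> inside la y ==>
    (((x.1 == y.1) && (x.2 < y.2)%N) ==> (S x <= S y)%N) &&
    (((x.2 == y.2) && (x.1 < y.1)%N) ==> (S x < S y)%N)].

Lemma ssytP k la S : reflect
  [/\ forall x, inside la x -> (S x < k)%N,
      forall x, ~~ inside la x -> S x = k :> nat,
      forall r (c d : 'I_N), inside la (r, c) -> inside la (r, d) ->
        (c < d)%N -> (S (r, c) <= S (r, d))%N &
      forall (r q : 'I_K) c, inside la (r, c) -> inside la (q, c) ->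
        (r < q)%N -> (S (r, c) < S (q, c))%N]
  (ssyt k la S).
Proof.
apply: (iffP andP) => [[/forallP h1 /forallP h2]|[h1 h2 h3 h4]].
  split=> [x|x|r c d rc rd cd|r q c rc qc rq].
  - by move=> ix; have := h1 x; rewrite ix.
  - by move=> /negPf ix; have := h1 x; rewrite ix => /eqP.
  - by have /forallP/(_ (r, d)) := h2 (r, c);
      rewrite rc rd /= eqxx cd => /andP[].
  - by have /forallP/(_ (q, c)) := h2 (r, c);
      rewrite rc qc /= eqxx rq => /andP[].
split; apply/forallP => x.
  by case: ifPn => [/h1|/h2 ->].
apply/forallP => y; apply/implyP => ix; apply/implyP => iy.
case: x y ix iy => [r c] [q d] ix iy /=; apply/andP; split.
  by apply/implyP => /andP[/eqP rq cd]; subst q; exact: h3.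
by apply/implyP => /andP[/eqP cd rq]; subst d; exact: h4.
Qed.

Section Branching.
Variables (k : nat) (la : nat -> nat).
Hypotheses (kK : (k < K)%N) (la_shape : row_shape k.+1 N la)
  (la0 : forall r, (k < r)%N -> la r = 0%N).

Let la_ltN r : (la r < N)%N.
Proof. by have [rk|rk] := ltnP k r; [rewrite la0|apply: la_shape.2]. Qed.

Let la_leq r q : (r <= q)%N -> (la q <= la r)%N.
Proof.
move=> /subnK <-; elim: (q - r)%N => // i IH; rewrite addSn.
apply: leq_trans IH; have [ik|ik] := ltnP (i + r).+1 k.+1.
  exact: la_shape.1.
by rewrite la0 // ltnS.
Qed.

(** The shape of the cells with entry less than k. *)
Definition subshape S : {ffun 'I_k -> 'I_N} :=
  [ffun j : 'I_k => inord (find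
    (fun c => ~~ (S (inord j, inord c) < k)%N) (iota 0 N'))].

(** The tableau S with its cells of entry k moved outside of the shape; the
    cells outside of the shape have value k + 1 in S and k in the result. *)
Definition restr_filling S : filling :=
  [ffun x => if (S x < k)%N then S x else inord k].

(** The inverse operation: the cells of la outside of the shape of S get the
    entry k. *)
Definition ext_filling S : filling :=
  [ffun x => if (S x < k)%N then S x else
     if inside la x then inord k else inord k.+1].

Lemma inord_valK n (i : 'I_n.+1) m : i = m :> nat -> inord m = i.
Proof. by move=> <-; exact: inord_val. Qed.

Lemma subshapeP S (j : 'I_k) (r : 'I_K) (c : 'I_N) :
  ssyt k.+1 la S -> r = j :> nat -> (S (r, c) < k)%N = (c < subshape S j)%N.
Proof.
move=> /ssytP[h1 h2 h3 _] rj; rewrite /subshape ffunE (inord_valK rj).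
set a := fun c : nat => _; set s := iota 0 N'.
have fN : (find a s <= N')%N by rewrite (leq_trans (find_size _ _)) //
  size_iota.
rewrite inordK //; apply/idP/idP => [Sk|cf]; last first.
  have := before_find 0%N cf; rewrite nth_iota ?(leq_trans cf) // add0n /a.
  by rewrite inord_val => /negbT; rewrite negbK.
rewrite ltnNge; apply/negP => fc.
have ic : inside la (r, c).
  by apply: contraTT Sk => /h2 ->; rewrite -leqNgt.
have fNl : (find a s < size s)%N.
  rewrite size_iota (leq_ltn_trans fc) //; have := la_ltN r.
  rewrite ltnS; exact: leq_trans.
have : a (find a s).
  have := nth_find 0%N; rewrite -has_find in fNl => /(_ _ _ fNl).
  by rewrite nth_iota -?has_find ?size_iota // -[X in (_ < X)%N](size_iota 0)
    -has_find.
rewrite /a => /negP; apply.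
have [->|fcn] := eqVneq (find a s) c; first by rewrite inord_val.
apply: leq_ltn_trans Sk; apply: h3 => //.
  by rewrite /inside /= inordK // (leq_ltn_trans fc).
by rewrite inordK // ltn_neqAle fcn.
Qed.

(** The entries of a column strictly increase, so that the entry in row r is
    at least r. *)
Lemma ssyt_row_le n S (r : 'I_K) (c : 'I_N) :
  ssyt n la S -> inside la (r, c) -> (r <= S (r, c))%N.
Proof.
move=> /ssytP[_ _ _ h4]; case: r => r rK; elim: r rK => [//|r IH] rK ic.
have rK' : (r < K)%N by exact: ltnW.
have ic' : inside la (Ordinal rK', c).
  by apply: leq_trans ic _; exact: la_leq.
apply: leq_ltn_trans (IH rK' ic') _.
by apply: h4.
Qed.

Lemma subshape_interlace S : ssyt k.+1 la S -> interlace la (subshape S).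
Proof.
move=> hS; apply/forallP => j; have jK : (j < K)%N by exact: ltn_trans kK.
have j1K : (j.+1 < K)%N by exact: leq_ltn_trans kK.
have /ssytP[h1 h2 h3 h4] := hS.
have H c : (c < N)%N -> (S (Ordinal jK, inord c) < k)%N = (c < subshape S j)%N.
  by move=> cN; rewrite (@subshapeP _ j) // inordK.
apply/andP; split.
  case e : (la j.+1) => [//|c].
  have cN : (c < N)%N by have := la_ltN j.+1; rewrite e => /ltnW.
  rewrite -H //.
  have i1 : inside la (Ordinal j1K, inord c) by rewrite /inside /= inordK // e.
  have i0 : inside la (Ordinal jK, inord c).
    by apply: leq_trans i1 _; exact: la_leq.
  by apply: leq_trans (h4 _ _ _ i0 i1 _) _ => //; rewrite -ltnS h1.
rewrite leqNgt; apply/negP => lam.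
have := H _ (la_ltN j); rewrite lam h2 ?ltnNge ?leqnSn //.
by rewrite /inside /= inordK // ltnn.
Qed.

Lemma ssyt_restr S : ssyt k.+1 la S -> ssyt k (natf (subshape S))
  (restr_filling S).
Proof.
move=> hS; have /ssytP[h1 h2 h3 h4] := hS.
have /interlaceP il := subshape_interlace hS.
have iE x : inside (natf (subshape S)) x = (S x < k)%N.
  case: x => r c; rewrite /inside /=; have [rk|rk] := ltnP r k.
    by rewrite -[r : nat]/(nat_of_ord (Ordinal rk)) natfE -(@subshapeP _ _ r).
  rewrite natf_ge // ltn0; apply/esym/negbTE; rewrite -leqNgt.
  have [ic|/h2 ->] := boolP (inside la (r, c)); last exact: leqnSn.
  by rewrite (leq_trans rk) // (ssyt_row_le hS).
have iS x : (S x < k)%N -> inside la x.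
  by apply: contraTT => /h2 ->; rewrite -leqNgt.
apply/ssytP; split=> [x|x|r c e|r q c].
- by rewrite iE ffunE => Sx; rewrite Sx.
- by rewrite iE ffunE => /negPf ->; rewrite inordK // (ltn_trans kK).
- by rewrite !iE !ffunE => Sc Se; rewrite Sc Se; apply: h3; exact: iS.
- by rewrite !iE !ffunE => Sc Se; rewrite Sc Se; apply: h4; exact: iS.
Qed.

Lemma ext_restr S : ssyt k.+1 la S -> ext_filling (restr_filling S) = S.
Proof.
move=> /ssytP[h1 h2 _ _]; apply/ffunP => x; rewrite !ffunE; apply/val_inj.
have kK1 : (k < K.+1)%N by exact: ltn_trans kK _.
have [Sk|Sk] := ltnP (S x) k; first by rewrite Sk.
rewrite inordK // ltnn; case: ifPn => ix; last by rewrite /= inordK // h2.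
by rewrite /= inordK //; apply/eqP; rewrite eqn_leq Sk -ltnS h1.
Qed.

Section Extension.
Variables (m : {ffun 'I_k -> 'I_N}) (S : filling).
Hypotheses (lam : interlace la m) (hS : ssyt k (natf m) S).

Let m_la r : (natf m r <= la r)%N.
Proof.
have [rk|rk] := ltnP r k; last by rewrite natf_ge.
by have /interlaceP/(_ _ rk)/andP[] := lam.
Qed.

Let iE x : inside (natf m) x = (S x < k)%N.
Proof.
have /ssytP[h1 h2 _ _] := hS.
by apply/idP/idP => [/h1//|]; apply: contraTT => /h2 ->; rewrite ltnn.
Qed.

Let Sk x : ~~ (S x < k)%N -> S x = k :> nat.
Proof. by have /ssytP[_ h2 _ _] := hS; rewrite -iE; exact: h2. Qed.

Let kK1 : (k < K.+1)%N. Proof. exact: ltn_trans kK _. Qed.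

Let extE x : ext_filling S x =
  (if (S x < k)%N then S x : nat else if inside la x then k else k.+1) :> nat.
Proof. by rewrite ffunE; do 2?case: ifP => _ //; rewrite inordK. Qed.

Let i_la x : (S x < k)%N -> inside la x.
Proof. by rewrite -iE => /leq_trans; apply. Qed.

Lemma ssyt_ext : ssyt k.+1 la (ext_filling S).
Proof.
have /ssytP[h1 h2 h3 h4] := hS.
apply/ssytP; split=> [x ix|x ix|r c e rc re ce|r q c rc qc rq]; rewrite ?extE.
- by rewrite ix; case: ifP => // /ltnW.
- by rewrite (negPf ix) ifN //; apply: contra ix; exact: i_la.
- rewrite rc re; case: ifP => Sc; case: ifP => Se //; last 2 first.
  + exact: ltnW.
  + move: Se; rewrite -iE => ie; move: Sc; rewrite -iE => /negP[].
    by move: ie; rewrite /inside /=; exact: ltn_trans.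
  by apply: h3; rewrite ?iE.
rewrite rc qc; case: ifP => Sc; case: ifP => Se //.
- by apply: h4; rewrite ?iE.
- move: Sc; rewrite -iE => /negP[]; apply: leq_trans (qc : (c < la q)%N) _.
  have rk : (r < k)%N.
    have : (q < k.+1)%N by rewrite ltnNge; apply: contraL qc => /la0 H;
      rewrite /inside H.
    by rewrite ltnS; exact: leq_trans.
  have /interlaceP/(_ _ rk)/andP[+ _] := lam.
  by apply: leq_trans; apply: la_leq.
- move: Sc; rewrite -iE => /negP[]; apply: leq_trans (qc : (c < la q)%N) _.
  have rk : (r < k)%N.
    have : (q < k.+1)%N by rewrite ltnNge; apply: contraL qc => /la0 H;
      rewrite /inside H.
    by rewrite ltnS; exact: leq_trans.
  have /interlaceP/(_ _ rk)/andP[+ _] := lam.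
  by apply: leq_trans; apply: la_leq.
Qed.

Lemma ext_lt x : (ext_filling S x < k)%N = (S x < k)%N.
Proof.
by rewrite extE; case: ifP => // _; case: ifP; rewrite ?ltnn // ltnNge leqnSn.
Qed.

Lemma subshape_ext : subshape (ext_filling S) = m.
Proof.
apply/ffunP => j; apply/val_inj/eqP.
have jK : (j < K)%N by exact: ltn_trans kK.
have H c : (c < N)%N -> (c < subshape (ext_filling S) j)%N = (c < m j)%N.
  move=> cN; have := @subshapeP _ j (Ordinal jK) (Ordinal cN) ssyt_ext erefl.
  by rewrite ext_lt -iE /inside /= natfE => <-.
rewrite eqn_leq; apply/andP; split; rewrite leqNgt; apply/negP => lt.
  by have := H _ (ltn_ord (m j)); rewrite lt ltnn.
by have := H _ (ltn_ord (subshape (ext_filling S) j)); rewrite lt ltnn.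
Qed.

Lemma restr_ext : restr_filling (ext_filling S) = S.
Proof.
apply/ffunP => x; rewrite ffunE ext_lt; apply/val_inj.
case: ifPn => Sx; first by rewrite /= extE Sx.
by rewrite /= inordK // Sk.
Qed.

Lemma prod_ext (R : comNzRingType) (p : nat -> R) :
  \prod_(x | inside la x) p (ext_filling S x) =
  (\prod_(r < K) p k ^+ (la r - natf m r)) *
  \prod_(x | inside (natf m) x) p (S x).
Proof.
rewrite (bigID (inside (natf m))) /= mulrC; congr (_ * _); last first.
  apply: eq_big => [x|x /andP[_]]; last by rewrite iE extE => ->.
  by rewrite andbC; case: (boolP (inside (natf m) x)) => //;
    rewrite iE => /i_la.
rewrite (eq_bigr (fun=> p k)) => [|x /andP[ix]]; last first.
  by rewrite iE extE ix => /negPf ->.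
rewrite -(pair_big_dep predT (fun (r : 'I_K) (c : 'I_N) =>
   (c < la r) && ~~ (c < natf m r))%N (fun _ _ => p k)) /=.
apply: eq_bigr => r _; rewrite big_const iter_mulr_1; congr (_ ^+ _).
rewrite -sum1_card.
transitivity (\sum_(natf m r <= c < la r) 1)%N;
  last by rewrite sum_nat_const_nat muln1.
rewrite (big_nat_widenl _ 0) // (big_nat_widen _ _ N) ?(ltnW (la_ltN r)) //.
rewrite big_mkord; apply: eq_bigl => c.
by rewrite unfold_in -leqNgt andbC.
Qed.

End Extension.
End Branching.

(** The Schur function as a sum over semistandard tableaux. *)
Definition tabsum (R : comNzRingType) k la (p : nat -> R) : R :=
  \sum_(S | ssyt k la S) \prod_(x | inside la x) p (S x).

Lemma ffpow_th0 (R : comNzRingType) a (x : R) : ffpow 0 a x = x ^+ a.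
Proof.
rewrite /ffpow; under eq_bigr do rewrite mulr0 subr0.
by rewrite big_const_nat iter_mulr_1 subn0.
Qed.

(** The branching rule: a tableau with entries at most k amounts to the
    interlacing shape of its entries less than k together with the tableau that
    these entries form. *)
Theorem tabsum_fschur (R : comNzRingType) k la (p : nat -> R) :
  (k <= K)%N -> row_shape k N la -> (forall r, (k <= r)%N -> la r = 0%N) ->
  tabsum k la p = fschur N 0 k la p.
Proof.
elim: k la => [|k IH] la kK sh la0.
  have i0 x : inside la x = false by rewrite /inside la0.
  rewrite /tabsum (big_pred1 [ffun=> ord0]) => [|S].
    by rewrite big_pred0.
  apply/ssytP/eqP => [[_ h _ _]|->].
    by apply/ffunP => x; apply/val_inj; rewrite ffunE /= h ?i0.
  split=> [x|x|r c e|r q c]; rewrite ?i0 //.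
  by rewrite ffunE.
rewrite /tabsum (partition_big (@subshape k) (fun m => interlace la m)) /=;
  last first.
  by move=> S; exact: subshape_interlace.
rewrite mulr_sumr; apply: eq_bigr => m lam.
rewrite (reindex_onto (ext_filling k la) (restr_filling k)) /=; last first.
  by move=> S /andP[hS _]; exact: ext_restr.
have sm : row_shape k N (natf m) by exact: shape_interlace sh lam.
rewrite -(IH (natf m)) ?(ltnW kK) //; last by move=> r; exact: natf_ge.
have cE S : ((ssyt k.+1 la (ext_filling k la S)
      && (subshape k (ext_filling k la S) == m))
      && (restr_filling k (ext_filling k la S) == S)) = ssyt k (natf m) S.
  apply/idP/idP => [/andP[/andP[hS /eqP <-] /eqP {2}<-]|hS].
    by apply: (ssyt_restr kK sh la0).
  rewrite (ssyt_ext kK sh la0 lam hS) (restr_ext _ kK hS).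
  by rewrite (subshape_ext kK sh la0 lam hS) !eqxx.
rewrite (eq_bigl _ _ cE) /tabsum mulrA.
rewrite [RHS]mulr_sumr; apply: eq_bigr => S hS.
rewrite (prod_ext kK sh la0 lam hS); congr (_ * _).
pose f r := p k ^+ (la r - natf m r).
rewrite (_ : \prod_(r < K) _ = \prod_(0 <= r < K) f r);
  last by rewrite big_mkord.
rewrite (@big_cat_nat _ _ _ k.+1) //= big_nat_recr //= ffpow_th0.
rewrite [X in _ * X]big_nat_cond [X in _ * X]big1 ?mulr1; last first.
  by move=> r /andP[/andP[kr _] _]; rewrite /f la0.
have -> : f k = p k ^+ la k by rewrite /f natf_ge // subn0.
rewrite mulrC; congr (_ * _).
rewrite big_mkord; apply: eq_bigr => j _.
under [RHS]eq_bigr do rewrite mulr0 subr0.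
rewrite big_const_nat iter_mulr_1 /f natfE; congr (_ ^+ _).
by rewrite -addnS -subSn // subSS subnDr.
Qed.

End Tableaux.

(** A filling of the cells of la is a filling of the rectangle that is constant
    outside of la, through the following correspondence between cells. *)
Section SchurTableaux.
Variables (K' N' : nat) (la : diagram) (R : realType) (p : 'I_K'.+1 -> R).
Local Notation K := K'.+1.
Local Notation N := N'.+1.
Local Notation box := ('I_K * 'I_N)%type.
Local Notation filling := {ffun box -> 'I_K.+1}.
Hypotheses (laK : (size la <= K)%N) (laN : forall j, (nth 0 la j < N)%N).

Local Notation lam := (nth 0%N la).

Let box_of (c : cell la) : box := (inord (cell_row c), inord (cell_col c)).

Let row_lt (c : cell la) : (cell_row c < K)%N.
Proof. by apply: leq_trans laK; exact: ltn_ord. Qed.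

Let col_lt (c : cell la) : (cell_col c < N)%N.
Proof. by apply: leq_trans (laN (tag c)); rewrite ltnS ltnW // ltn_ord. Qed.

Let box_row c : (box_of c).1 = cell_row c :> nat.
Proof. by rewrite /= inordK // row_lt. Qed.

Let box_col c : (box_of c).2 = cell_col c :> nat.
Proof. by rewrite /= inordK // col_lt. Qed.

Let box_inside c : inside lam (box_of c).
Proof. by rewrite /inside box_row box_col; exact: ltn_ord. Qed.

Let cell_of (x : box) : option (cell la) :=
  if (insub (x.1 : nat) : option 'I_(size la)) is Some i then
    if (insub (x.2 : nat) : option 'I_(lam i)) is Some j
    then Some (Tagged (fun i : 'I_(size la) => 'I_(lam i)) j) else None
  else None.

Let cell_of_some x c : cell_of x = Some c -> box_of c = x.
Proof.
rewrite /cell_of; case: insubP => // i _ ix; case: insubP => // j _ jx [<-].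
case: x ix jx => r d /= ir jd; congr pair; apply/val_inj.
  by rewrite /= inordK /cell_row /= ir.
by rewrite /= inordK /cell_col /= jd.
Qed.

Let cell_of_inside x : inside lam x -> exists c, cell_of x = Some c.
Proof.
rewrite /inside => ix; have xs : (x.1 < size la)%N.
  by rewrite ltnNge; apply: contraTN ix => h; rewrite nth_default.
rewrite /cell_of; case: insubP => [i _ ei|]; last by rewrite xs.
case: insubP => [j _ ej|]; last by rewrite ei ix.
by eexists.
Qed.

Let box_of_inj : injective box_of.
Proof.
move=> c c' e.
have := congr1 (fun x : box => x.1 : nat) e; rewrite !box_row => er.
have := congr1 (fun x : box => x.2 : nat) e; rewrite !box_col => ec.
case: c c' er ec {e} => i j [i' j'] /= ei ej.
have ii : i = i' by apply/val_inj.
by subst i'; congr Tagged; apply/val_inj.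
Qed.

Let cell_ofK c : cell_of (box_of c) = Some c.
Proof.
have [c' e] := cell_of_inside (box_inside c).
by rewrite e; congr Some; apply: box_of_inj; exact: cell_of_some.
Qed.

Let cell_of_none x : ~~ inside lam x -> cell_of x = None.
Proof.
move=> nx; case e : (cell_of x) => [c|//].
by move: nx; rewrite -(cell_of_some e) box_inside.
Qed.

Let fill (S : {ffun cell la -> 'I_K}) : filling :=
  [ffun x => if cell_of x is Some c then inord (S c) else ord_max].

Let unfill (S : filling) : {ffun cell la -> 'I_K} :=
  [ffun c => inord (S (box_of c))].

Let fill_box S c : fill S (box_of c) = S c :> nat.
Proof. by rewrite ffunE cell_ofK inordK // ltnS ltnW // ltn_ord. Qed.

Lemma ssyt_fill S : ssyt K lam (fill S) = semistandard S.
Proof.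
apply/ssytP/idP => [[_ _ h3 h4]|/forallP ss].
  apply/forallP => c; apply/forallP => c'.
  have := box_inside c; have := box_inside c'.
  move: (fill_box S c) (fill_box S c') (box_row c) (box_row c') (box_col c)
    (box_col c').
  case: (box_of c) => r d; case: (box_of c') => r' d' /= <- <- <- <- <- <- i' i.
  apply/andP; split; apply/implyP => /andP[/eqP/val_inj e lt]; subst.
    exact: h3.
  exact: h4.
split=> [x ix|x ix|r c d|r q c].
- have [c /cell_of_some <-] := cell_of_inside ix.
  by rewrite fill_box ltn_ord.
- by rewrite ffunE cell_of_none.
- move=> /cell_of_inside[c1 /cell_of_some e1]
    /cell_of_inside[c2 /cell_of_some e2].
  rewrite -e1 -e2 !fill_box => cd; have /forallP/(_ c2)/andP[/implyP h _] := ss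
    c1.
  by apply: h; rewrite -!box_row -!box_col e1 e2 /= eqxx.
- move=> /cell_of_inside[c1 /cell_of_some e1]
    /cell_of_inside[c2 /cell_of_some e2].
  rewrite -e1 -e2 !fill_box => cd; have /forallP/(_ c2)/andP[_ /implyP h] := ss
    c1.
  by apply: h; rewrite -!box_row -!box_col e1 e2 /= eqxx.
Qed.

Lemma fillK : cancel fill unfill.
Proof.
move=> S; apply/ffunP => c; rewrite ffunE; apply/val_inj.
by rewrite /= inordK fill_box ?ltn_ord.
Qed.

Lemma unfillK S : ssyt K lam S -> fill (unfill S) = S.
Proof.
move=> /ssytP[h1 h2 _ _]; apply/ffunP => x; apply/val_inj.
have [ix|ix] := boolP (inside lam x); last first.
  by rewrite /= ffunE cell_of_none //= h2.
have [c /cell_of_some <-] := cell_of_inside ix.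
by rewrite /= fill_box ffunE inordK // h1 // box_inside.
Qed.

Lemma schur_tabsum : schur la p = tabsum K' N' K lam (fun i => p (inord i)).
Proof.
rewrite /schur /tabsum (reindex_onto fill unfill) /=; last exact: unfillK.
apply: eq_big => [S|S _]; first by rewrite ssyt_fill fillK eqxx andbT.
transitivity (\prod_(c : cell la) p (S c)).
  rewrite (partition_big S predT) //=; apply: eq_bigr => i _.
  rewrite (eq_bigr (fun=> p i)) => [|c /eqP -> //].
  by rewrite big_const iter_mulr_1.
have box_on x : inside lam x -> omap box_of (cell_of x) = Some x.
  by move=> /cell_of_inside[c e]; rewrite e /= (cell_of_some e).
have [c0 _|nc] := pickP (fun c : cell la => true); last first.
  rewrite big_pred0; last by move=> c; have := nc c.
  rewrite big_pred0 // => x; apply/negbTE/negP => /cell_of_inside[c _].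
  by have := nc c.
rewrite (reindex_onto box_of (fun x => odflt c0 (cell_of x))) /=; last first.
  by move=> x /cell_of_inside[c e]; rewrite e /= (cell_of_some e).

apply: eq_big => [c|c _]; first by rewrite box_inside cell_ofK /= eqxx.
by congr p; apply/val_inj; rewrite /= fill_box inordK ?ltn_ord.
Qed.

Lemma schur_fschur :
  schur la p = fschur N 0 K lam (fun i => p (inord i)).
Proof.
rewrite schur_tabsum tabsum_fschur //.
  split => // j _; have /andP[sl _] := rowsP la.
  have [js|js] := ltnP j.+1 (size la); last by rewrite nth_default.
  exact: (sortedP 0%N sl).
by move=> r Kr; rewrite nth_default // (leq_trans laK).
Qed.

End SchurTableaux.

Lemma schur_fschur_gt0 k N (la : diagram) (R : realType) (p : 'I_k -> R)
    (q : nat -> R) :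
  (0 < k)%N -> (size la <= k)%N -> (forall j, nth 0 la j < N)%N ->
  (forall i : 'I_k, p i = q i) ->
  schur la p = fschur N 0 k (nth 0%N la) q.
Proof.
case: k p => // K' p _ lak laN pq.
case: N laN => [/(_ 0%N)//|N' laN]; rewrite (schur_fschur p lak laN).
by apply: eq_fschur => j jk; rewrite pq inordK.
Qed.

(** The first column of a semistandard tableau strictly increases, hence has at
    most as many cells as there are possible entries. *)
Lemma schur_eq0 (la : diagram) k (R : realType) (p : 'I_k -> R) :
  (k < size la)%N -> schur la p = 0.
Proof.
move=> kla; rewrite /schur big_pred0 // => S; apply/negP => /forallP ss.
have row0 i : (i < size la)%N -> (0 < nth 0 la i)%N.
  have /andP[_ la0] := rowsP la; move=> is_.
  by rewrite lt0n; apply: contraNneq la0 => <-; exact: mem_nth.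
pose c i (h : (i < size la)%N) : cell la :=
  Tagged (fun i : 'I_(size la) => 'I_(nth 0%N la i))
    (Ordinal (row0 i h) : 'I_(nth 0%N la (Ordinal h))).
have H i (h : (i < size la)%N) : (i <= S (c i h))%N.
  elim: i h => [//|i IH] h; apply: leq_ltn_trans (IH (ltnW h)) _.
  have /forallP/(_ (c _ h))/andP[_ /implyP] := ss (c _ (ltnW h)).
  by apply; rewrite /cell_row /cell_col /=; exact: leqnn.
by have := H _ kla; rewrite leqNgt ltn_ord.
Qed.

(** * Central measures on the path space of a graded graph *)

Section Levels.
Variable G : gradedGraph.
Implicit Types (u v w x : G) (t : infpath G).

(** The vertices of level n, listed without repetition. *)
Definition levelseq n : seq G := enum_fset (fset_set [set v : G | level v = n]).

Lemma levelseq_uniq n : uniq (levelseq n).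
Proof. exact: fset_uniq. Qed.

Lemma mem_levelseq n v : (v \in levelseq n) = (level v == n).
Proof.
rewrite -[LHS]/(v \in fset_set _) in_fset_set; last exact: finite_level.
by apply/idP/eqP; rewrite inE.
Qed.

(** The finite paths from the source to v, listed without repetition. *)
Definition finpathseq v : seq (seq G) := enum_fset (fset_set (finpaths v)).

Lemma finpathseq_uniq v : uniq (finpathseq v).
Proof. exact: fset_uniq. Qed.

Lemma mem_finpathseq v p : p \in finpathseq v <-> finpaths v p.
Proof.
rewrite -[p \in _]/(p \in fset_set _) in_fset_set; last exact: finite_finpaths.
by split; rewrite inE.
Qed.

Lemma pathdimE v : pathdim v = size (finpathseq v).
Proof. by []. Qed.

Lemma finpaths_rcons x w p : edge x w -> finpaths x p -> finpaths w (rcons p w).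
Proof.
by move=> xw [pp px]; split; rewrite ?last_rcons // rcons_path pp px.
Qed.

(** A path to a vertex w of positive level arises in exactly one way from a
    path to a predecessor of w. *)
Lemma perm_finpathseq w : (0 < level w)%N ->
  perm_eq (finpathseq w) (flatten [seq [seq rcons p w | p <- finpathseq x]
     | x <- [seq x <- levelseq (level w).-1 | edge x w]]).
Proof.
move=> w0; apply: uniq_perm; first exact: finpathseq_uniq.
  rewrite -[flatten _]/(allpairs_dep (fun x p => rcons p w) _ _).
  apply: allpairs_uniq_dep => [|x _|].
  - by rewrite filter_uniq // levelseq_uniq.
  - exact: finpathseq_uniq.
  move=> [x p] [y q] /allpairsPdep[x' [p' [_ /mem_finpathseq[_ px] [-> ->]]]].
  move=> /allpairsPdep[y' [q' [_ /mem_finpathseq[_ qy] [-> ->]]]] /= /rcons_inj.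
  by case=> e; rewrite -px -qy e.
move=> p; apply/idP/allpairsPdep => [/mem_finpathseq[pp pw]|].
  case/lastP: p pp pw => [_ w1|p y]; first by rewrite -w1 level_source in w0.
  rewrite rcons_path last_rcons => /andP[pp py] yw; rewrite -{}yw in w0 *.
  exists (last (source G) p), p; split => //; last exact/mem_finpathseq.
  by rewrite mem_filter py mem_levelseq (edge_level py) /=.
move=> [x [q [+ /mem_finpathseq qx ->]]].
rewrite mem_filter => /andP[xw _].
exact/mem_finpathseq/(finpaths_rcons xw).
Qed.

Lemma pathdim_rec w : (0 < level w)%N ->
  pathdim w = (\sum_(x <- levelseq (level w).-1 | edge x w) pathdim x)%N.
Proof.
move=> w0; rewrite pathdimE (perm_size (perm_finpathseq w0)).
rewrite size_flatten /shape -map_comp sumnE big_map big_filter.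
by apply: eq_bigr => x _ /=; rewrite size_map.
Qed.

Lemma pathdim_source : pathdim (source G) = 1%N.
Proof.
rewrite pathdimE (_ : finpathseq _ = [:: [::]]) //.
apply/perm_small_eq => //; apply: uniq_perm => // [|p].
  exact: finpathseq_uniq.
apply/idP/idP => [/mem_finpathseq /size_finpath|].
  by rewrite level_source => /size0nil ->.
by rewrite inE => /eqP ->; exact/mem_finpathseq.
Qed.

(** The number of paths of length i from v to w, for w of level
    [level v + i]. *)
Fixpoint npath v i w : nat :=
  if i is j.+1 then (\sum_(x <- levelseq (level w).-1 | edge x w) npath v j x)%N
  else (w == v).

Lemma npath_source w : npath (source G) (level w) w = pathdim w.
Proof.
move en : (level w) => n; elim: n w en => [|n IH] w wn /=.
  have [->|wnz] := eqVneq w; first by rewrite pathdim_source.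
  rewrite pathdimE; case e: (finpathseq w) => [//|p s].
  have /mem_finpathseq : p \in finpathseq w by rewrite e inE eqxx.
  move=> /[dup] /size_finpath; rewrite wn => /size0nil -> [_ /esym/eqP].
  by rewrite (negPf wnz).
rewrite pathdim_rec wn //= big_seq_cond [RHS]big_seq_cond.
by apply: eq_bigr => x /andP[]; rewrite mem_levelseq => /eqP xn _; exact: IH.
Qed.

Lemma leq_npath v i w : level w = (level v + i)%N ->
  (pathdim v * npath v i w <= pathdim w)%N.
Proof.
elim: i w => [|i IH] w wi /=.
  by have [->|_] := eqVneq; rewrite ?muln1 ?muln0.
rewrite (@pathdim_rec w) wi addnS //= big_distrr /= big_seq_cond.
rewrite [leqRHS]big_seq_cond; apply: leq_sum => x /andP[].
by rewrite mem_levelseq => /eqP xn _; exact: IH.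
Qed.

Lemma level_infpath t n : level (t n) = n.
Proof.
elim: n => [|n IH]; first by rewrite infpath0 level_source.
by rewrite (edge_level (infpathS t n)) IH.
Qed.

Lemma mem_levelseq_infpath t n : t n \in levelseq n.
Proof. by rewrite mem_levelseq level_infpath. Qed.

(** The first n vertices of the path t after the source. *)
Definition trunc t n : seq G := mkseq (fun i => t i.+1) n.

Lemma truncS t n : trunc t n.+1 = rcons (trunc t n) (t n.+1).
Proof. exact: mkseqS. Qed.

Lemma last_trunc t n : last (source G) (trunc t n) = t n.
Proof.
by case: n => [|n]; rewrite ?infpath0 // truncS last_rcons.
Qed.

Lemma finpaths_trunc t n : finpaths (t n) (trunc t n).
Proof.
elim: n => [|n IH]; first by split => //=; rewrite infpath0.
by rewrite truncS; exact: finpaths_rcons (infpathS t n) IH.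
Qed.

Lemma initialE p v t : finpaths v p ->
  initial p t <-> trunc t (level v) = p.
Proof. by move=> /size_finpath <-. Qed.

Lemma initial_cylinder p v : finpaths v p -> initial p `<=` cylinder v.
Proof.
move=> pv t /(initialE _ pv) tp; rewrite /cylinder /= -last_trunc tp.
by case: pv.
Qed.

Lemma initial_rcons p x w : finpaths x p -> edge x w ->
  initial (rcons p w) = initial p `&` cylinder w.
Proof.
move=> px xw; apply/seteqP; split => t; rewrite /cylinder /= (edge_level xw).
  move=> /(initialE _ (finpaths_rcons xw px)); rewrite (edge_level xw) truncS.
  by move=> /rcons_inj[tp tw]; split=> //; exact/(initialE _ px).
move=> [/(initialE _ px) tp tw]; apply/(initialE _ (finpaths_rcons xw px)).
by rewrite (edge_level xw) truncS tp tw.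
Qed.

Lemma cylinder_initial v t : cylinder v t ->
  exists2 p, p \in finpathseq v & initial p t.
Proof.
rewrite /cylinder /= => tv; exists (trunc t (level v)).
  by apply/mem_finpathseq; rewrite -[X in finpaths X]tv; exact: finpaths_trunc.
by rewrite /initial /= size_mkseq.
Qed.

Lemma initial_disj v p q t : finpaths v p -> finpaths v q ->
  initial p t -> initial q t -> p = q.
Proof. by move=> pv qv /(initialE _ pv) <- /(initialE _ qv) <-. Qed.

Lemma future_sub n m : (n <= m)%N -> future_events G m `<=` future_events G n.
Proof.
move=> nm; apply: sub_sigma_algebra2 => A [i mi Ai]; exists i => //=.
exact: leq_trans nm mi.
Qed.

Lemma future_measurable n (A : set (path_space G)) :
  future_events G n A -> measurable A.
Proof. by apply: future_sub. Qed.

Lemma futureI n A B : future_events G n A -> future_events G n B ->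
  future_events G n (A `&` B).
Proof. exact: (@measurableI _ (g_sigma_algebraType (coord_events G n))). Qed.

Lemma futureT n : future_events G n setT.
Proof. exact: (@measurableT _ (g_sigma_algebraType (coord_events G n))). Qed.

Lemma future_coord n m (A : set G) : (n <= m)%N ->
  future_events G n [set t : infpath G | A (t m)].
Proof.
move=> nm; apply: sub_sigma_algebra; exists m => //.
by exists A => //; rewrite setTI.
Qed.

Lemma future_cylinder n w : (n <= level w)%N ->
  future_events G n (cylinder w).
Proof. by move=> nw; exact: (future_coord [set w] nw). Qed.

Lemma measurable_cylinder w : measurable (cylinder w : set (path_space G)).
Proof. exact: (@future_cylinder 0). Qed.

Lemma measurable_initial p : measurable (initial p : set (path_space G)).
Proof.
have -> : initial p = \bigcap_(i in `I_(size p))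
    [set t : infpath G | t i.+1 = nth (source G) p i].
  apply/seteqP; split=> t; rewrite /initial /= => tp.
    by move=> i /= ip; rewrite -[in RHS]tp nth_mkseq.
  apply: (@eq_from_nth _ (source G)); first by rewrite size_mkseq.
  by move=> i; rewrite size_mkseq => ip; rewrite nth_mkseq // tp.
apply: fin_bigcap_measurable => // i _.
exact: (future_coord [set nth (source G) p i] (leq0n i.+1)).
Qed.

End Levels.

Section CentralMeasure.
Variables (G : gradedGraph) (R : realType) (P : probability (path_space G) R).
Implicit Types (u v w x : G) (A B : set (path_space G)).

Local Notation pr A := (fine (P A)).
Local Notation mble A := (@measurable _ (path_space G) A).

Lemma prE A : measurable A -> (pr A)%:E = P A.
Proof. by move=> mA; rewrite fineK // fin_num_measure. Qed.

Lemma pr_ge0 A : 0 <= pr A.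
Proof. by apply: fine_ge0; exact: measure_ge0. Qed.

Lemma prT : pr setT = 1.
Proof. by rewrite probability_setT. Qed.

Lemma pr0 : pr set0 = 0.
Proof. by rewrite measure0. Qed.

Lemma le_pr A B : measurable A -> measurable B -> A `<=` B -> pr A <= pr B.
Proof.
by move=> mA mB AB; rewrite -lee_fin !prE //; apply: le_measure; rewrite ?inE.
Qed.

(** Additivity over a finite partition. *)
Lemma pr_partition (I : eqType) (s : seq I) (A : I -> set (path_space G))
    (C : set (path_space G)) :
  uniq s -> (forall i, measurable (A i)) ->
  (forall t, C t <-> exists2 i, i \in s & A i t) ->
  (forall i j t, i \in s -> j \in s -> A i t -> A j t -> i = j) ->
  pr C = \sum_(i <- s) pr (A i).
Proof.
move=> us mA + disj; elim: s C us disj => [|i s IH] C /= us disj CE.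
  rewrite big_nil (_ : C = set0) ?pr0 //.
  by rewrite -subset0 => t /CE[].
move: us => /andP[is_ us]; pose D := \bigcup_(j in [set j | j \in s]) A j.
have DE t : D t <-> exists2 j, j \in s & A j t.
  by split=> -[j js Aj]; exists j.
have mD : measurable D.
  by apply: fin_bigcup_measurable => //; exact: finite_seq.
rewrite big_cons -(IH D) //; last first.
  by move=> j l t js ls; apply: disj; rewrite inE ?js ?ls orbT.
have -> : C = A i `|` D.
  apply/seteqP; split=> t.
    move=> /CE[j]; rewrite inE => /orP[/eqP -> Aj|js Aj]; first by left.
    by right; exists j.
  case=> [Ai|[j js Aj]]; apply/CE; first by exists i => //; exact: mem_head.
  by exists j => //; rewrite inE js orbT.
rewrite measureU // ?fineD ?fin_num_measure //.
rewrite -subset0 => t [Ai [j js Aj]].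
have ij : i = j by apply: (disj _ _ t) => //; rewrite ?mem_head // inE js orbT.
by move: is_; rewrite ij js.
Qed.

Section Central.
Hypothesis cP : central P.

(** Centrality in product form: given the future from the level of w on, each
    path to w takes the same share of the passage through w. *)
Lemma central_initial w p B : finpaths w p -> future_events G (level w) B ->
  (pathdim w)%:R * pr (initial p `&` B) = pr (cylinder w `&` B).
Proof.
move=> pw FB; have mB := future_measurable FB.
have mC : mble (cylinder w `&` B).
  by apply: measurableI => //; exact: measurable_cylinder.
have mi q : mble (initial q `&` B).
  by apply: measurableI => //; exact: measurable_initial.
have [C0|Cn0] := eqVneq (P (cylinder w)) 0%E.
  have H A : measurable A -> A `<=` cylinder w -> pr A = 0.
    move=> mA AC; apply/eqP; rewrite eq_le pr_ge0 andbT.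
    have <- : pr (cylinder w) = 0 by rewrite C0.
    by apply: le_pr => //; exact: measurable_cylinder.
  rewrite !H // ?mulr0 // => t [] //.
  by move=> /(initial_cylinder pw).
have /cP[f fP] : (0 < P (cylinder w))%E by rewrite lt0e Cn0 measure_ge0.
have fE q : finpaths w q -> pr (initial q `&` B) = pr (initial p `&` B).
  by move=> qw; have [_ _ <-//] := fP _ qw; have [_ _ <-//] := fP _ pw.
rewrite (@pr_partition _ (finpathseq w) (fun q => initial q `&` B) (cylinder w
  `&` B)) //.
- rewrite pathdimE big_seq (eq_bigr (fun=> pr (initial p `&` B))).
    by rewrite -big_seq big_const_seq count_predT iter_addr_0 mulr_natl.
  by move=> q /mem_finpathseq; exact: fE.
- exact: finpathseq_uniq.
- move=> t; split => [[/cylinder_initial[q qw qt] Bt]|[q /mem_finpathseq qw [qt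
    Bt]]].
    by exists q.
  by split => //; exact: initial_cylinder qw _ qt.
- move=> q r t /mem_finpathseq qw /mem_finpathseq rw [qt _] [rt _].
  exact: initial_disj qw rw qt rt.
Qed.

Lemma pathdim0_cylinder w : pathdim w = 0%N -> cylinder w = set0.
Proof.
rewrite pathdimE => /size0nil fw; rewrite -subset0 => t /cylinder_initial[p].
by rewrite fw.
Qed.

Lemma central_step x w B : edge x w -> future_events G (level w) B ->
  (pathdim w)%:R * pr (cylinder x `&` (cylinder w `&` B)) =
  (pathdim x)%:R * pr (cylinder w `&` B).
Proof.
move=> xw FB; have mB := future_measurable FB.
rewrite (@pr_partition _ (finpathseq x) (fun q => initial (rcons q w) `&` B)).
- rewrite mulr_sumr big_seq (eq_bigr (fun=> pr (cylinder w `&` B))).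
    by rewrite -big_seq big_const_seq count_predT iter_addr_0 mulr_natl.
  move=> q /mem_finpathseq qx; exact: central_initial (finpaths_rcons xw qx) FB.
- exact: finpathseq_uniq.
- by move=> q; apply: measurableI => //; exact: measurable_initial.
- move=> t; split.
    move=> [/cylinder_initial[p px pt] [wt Bt]]; exists p => //; split=> //.
    by move/mem_finpathseq: px => px; rewrite (initial_rcons px xw).
  move=> [p /mem_finpathseq px []]; rewrite (initial_rcons px xw).
  by move=> [pt wt] Bt; split=> //; exact: initial_cylinder px _ pt.
- move=> p q t /mem_finpathseq px /mem_finpathseq qx.
  rewrite (initial_rcons px xw) (initial_rcons qx xw) => -[[pt _] _] [[qt _] _].
  exact: initial_disj px qx pt qt.
Qed.

(** Given the future from the level of w on, the path having passed through w,
    the conditional probability of a passage through v is the proportion of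
    the paths to w that pass through v. *)
Lemma central_npath i v w B : level w = (level v + i)%N ->
  future_events G (level w) B ->
  (pathdim w)%:R * pr (cylinder v `&` (cylinder w `&` B)) =
  (pathdim v * npath v i w)%:R * pr (cylinder w `&` B).
Proof.
elim: i w B => [|i IH] w B wi FB /=.
  rewrite addn0 in wi; have [->|wv] := eqVneq.
    by rewrite muln1 setIA setIid.
  rewrite muln0 mul0r (_ : _ `&` _ = set0) ?pr0 ?mulr0 //.
  rewrite -subset0 => t [tv [tw _]]; move: tv tw wv; rewrite /cylinder /= wi.
  by move=> -> ->; rewrite eqxx.
have mCB : mble (cylinder w `&` B).
  apply: measurableI; [exact: measurable_cylinder|exact: future_measurable FB].
have mC := measurable_cylinder.
rewrite (@pr_partition _ [seq x <- levelseq G (level w).-1 | edge x w]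
  (fun x => cylinder v `&` (cylinder x `&` (cylinder w `&` B)))).
- rewrite [(pathdim v * _)%N]big_distrr /= natr_sum mulr_suml mulr_sumr
    big_filter.
  rewrite big_seq_cond [RHS]big_seq_cond; apply: eq_bigr => x /andP[].
  rewrite mem_levelseq => /eqP lx xw.
  have xi : level x = (level v + i)%N by rewrite lx wi addnS.
  have FCB : future_events G (level x) (cylinder w `&` B).
    apply: futureI; first by apply: future_cylinder; rewrite (edge_level xw).
    by apply: future_sub FB; rewrite (edge_level xw).
  have [x0|xn0] := eqVneq (pathdim x) 0%N.
    have := leq_npath xi; rewrite x0 leqn0 => /eqP ->.
    by rewrite (pathdim0_cylinder x0) set0I setI0 pr0 mulr0 mul0r.
  have x0 : (pathdim x)%:R != 0 :> R by rewrite pnatr_eq0.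
  apply: (mulfI x0); rewrite mulrCA IH // mulrCA central_step //; ring.
- by rewrite filter_uniq // levelseq_uniq.
- by move=> x; apply: measurableI => //; apply: measurableI.
- move=> t; split=> [[vt [wt Bt]]|[x _ [vt [_ [wt Bt]]]]]; last by split.
  have wE := edge_level (infpathS t (level w).-1).
  have wS : (level w).-1.+1 = level w by rewrite wi addnS.
  exists (t (level w).-1).
    rewrite mem_filter mem_levelseq_infpath andbT -[X in edge _ X]wt -wS.
    exact: infpathS.
  by split=> //; split=> //; rewrite /cylinder /= level_infpath.
- move=> x y t; rewrite !mem_filter !mem_levelseq.
  move=> /andP[_ /eqP xl] /andP[_ /eqP yl] [_ [xt _]] [_ [yt _]].
  by rewrite -xt -yt xl yl.
Qed.

(** The conditional probability of a passage through v, given the passage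
    through w. *)
Definition cprob v w : R := pr (cylinder v `&` cylinder w) / pr (cylinder w).

Lemma cprob_npath i v w : level w = (level v + i)%N -> pr (cylinder w) != 0 ->
  cprob v w = (pathdim v)%:R * ((npath v i w)%:R / (pathdim w)%:R).
Proof.
move=> wi w0; have := central_npath wi (@futureT G _); rewrite !setIT => H.
have dw : (pathdim w)%:R != 0 :> R.
  rewrite pnatr_eq0; apply: contra_neq w0 => /pathdim0_cylinder ->.
  exact: pr0.
rewrite /cprob mulrA -natrM; apply/eqP; rewrite eqr_div //; apply/eqP.
by rewrite -H mulrC.
Qed.

(** The conditional probability of a passage through v is not affected by
    further information on the future of w. *)
Lemma cprobP v w B : (level v <= level w)%N -> future_events G (level w) B ->
  pr (cylinder v `&` (cylinder w `&` B)) = cprob v w * pr (cylinder w `&` B).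
Proof.
move=> vw FB; have mB := future_measurable FB; have mC := measurable_cylinder.
have wi : level w = (level v + (level w - level v))%N by rewrite subnKC.
have mwB : mble (cylinder w `&` B) by exact: measurableI.
have [w0|w0] := eqVneq (pr (cylinder w)) 0.
  have H A : measurable A -> A `<=` cylinder w -> pr A = 0.
    by move=> mA AC; apply/eqP; rewrite eq_le pr_ge0 andbT -w0 le_pr.
  rewrite !H ?mulr0 //; first exact: measurableI.
  by move=> t [_ []].
have dw : (pathdim w)%:R != 0 :> R.
  rewrite pnatr_eq0; apply: contra_neq w0 => /pathdim0_cylinder ->.
  exact: pr0.
rewrite (cprob_npath wi w0); apply: (mulfI dw); rewrite (central_npath wi) //.
by rewrite natrM; field.
Qed.

Lemma cprob_ge0 v w : 0 <= cprob v w.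
Proof. by rewrite divr_ge0 // pr_ge0. Qed.

Lemma cprob_le1 v w : cprob v w <= 1.
Proof.
have mC := measurable_cylinder; rewrite /cprob.
have [->|w0] := eqVneq (pr (cylinder w)) 0; first by rewrite invr0 mulr0.
rewrite ler_pdivrMr ?lt_def ?w0 ?pr_ge0 // mul1r le_pr //.
exact: measurableI.
Qed.

Lemma pr_level n A : measurable A ->
  \sum_(w <- levelseq G n) pr (A `&` cylinder w) = pr A.
Proof.
move=> mA; apply/esym/pr_partition.
- exact: levelseq_uniq.
- by move=> w; apply: measurableI => //; exact: measurable_cylinder.
- move=> t; split=> [At|[w _ []]//]; exists (t n).
    exact: mem_levelseq_infpath.
  by split=> //; rewrite /cylinder /= level_infpath.
- move=> v w t; rewrite !mem_levelseq => /eqP vn /eqP wn [_ vt] [_ wt].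
  by rewrite -vt -wt vn wn.
Qed.

(** The second moment of the conditional probability of a passage through v
    given the future from level n on. *)
Definition moment2 v n : R :=
  \sum_(w <- levelseq G n) cprob v w ^+ 2 * pr (cylinder w).

Lemma moment1E v n : (level v <= n)%N ->
  \sum_(w <- levelseq G n) cprob v w * pr (cylinder w) = pr (cylinder v).
Proof.
move=> vn; rewrite -(@pr_level n (cylinder v)); last exact: measurable_cylinder.
rewrite big_seq [RHS]big_seq; apply: eq_bigr => w;
  rewrite mem_levelseq => /eqP wn.
by have := @cprobP v w setT; rewrite !setIT => -> //; rewrite ?wn //;
  exact: futureT.
Qed.

Lemma variance_const v n c : (level v <= n)%N ->
  \sum_(w <- levelseq G n) (cprob v w - c) ^+ 2 * pr (cylinder w) =
  moment2 v n - 2 * c * pr (cylinder v) + c ^+ 2.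
Proof.
move=> vn; rewrite -(moment1E vn) mulr_sumr -sumrB.
have S1 : \sum_(w <- levelseq G n) pr (cylinder w) = 1.
  rewrite -prT -(@pr_level n setT) //.
  by apply: eq_bigr => w _; rewrite setTI.
have -> : c ^+ 2 = c ^+ 2 * \sum_(w <- levelseq G n) pr (cylinder w).
  by rewrite S1 mulr1.
rewrite mulr_sumr -big_split /=.
by apply: eq_bigr => w _; ring.
Qed.

(** The conditional probabilities given the futures from two levels form a
    martingale, so that their increment has variance the difference of their
    second moments. *)
Lemma variance_increment v n m : (level v <= n)%N -> (n <= m)%N ->
  \sum_(w <- levelseq G n) \sum_(x <- levelseq G m)
     (cprob v w - cprob v x) ^+ 2 * pr (cylinder w `&` cylinder x) =
  moment2 v n - moment2 v m.
Proof.
move=> vn nm; have mC := measurable_cylinder.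
have E1 : \sum_(w <- levelseq G n) \sum_(x <- levelseq G m)
     cprob v w ^+ 2 * pr (cylinder w `&` cylinder x) = moment2 v n.
  by apply: eq_bigr => w _; rewrite -mulr_sumr pr_level.
have E2 : \sum_(w <- levelseq G n) \sum_(x <- levelseq G m)
     cprob v x ^+ 2 * pr (cylinder w `&` cylinder x) = moment2 v m.
  rewrite exchange_big; apply: eq_bigr => x _ /=; rewrite -mulr_sumr.
  by under eq_bigr => w _ do rewrite setIC; rewrite pr_level.
have E3 : \sum_(w <- levelseq G n) \sum_(x <- levelseq G m)
     cprob v w * cprob v x * pr (cylinder w `&` cylinder x) = moment2 v m.
  rewrite exchange_big /moment2 /= big_seq [RHS]big_seq.
  apply: eq_bigr => x; rewrite mem_levelseq => /eqP xm.
  rewrite expr2 -mulrA -[X in _ = _ * (_ * pr X)]setIT -cprobP ?xm //;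
    last 2 first.
  - exact: leq_trans nm.
  - exact: futureT.
  rewrite setIT -(@pr_level n (cylinder v `&` cylinder x));
    last exact: measurableI.
  rewrite mulr_sumr big_seq [RHS]big_seq; apply: eq_bigr => w.
  rewrite mem_levelseq => /eqP wn.
  rewrite mulrAC mulrC -cprobP ?wn //; last first.
    by apply: future_cylinder; rewrite xm.
  by rewrite setIA setIAC.
rewrite -E1 -[in RHS]E2.
have -> (a b : R) : a - b = a + b - 2 * b by ring.
rewrite [X in _ - 2 * X]E2 -E3 -big_split /= mulr_sumr -sumrB.
apply: eq_bigr => w _; rewrite -big_split /= mulr_sumr -sumrB.
apply: eq_bigr => x _; ring.
Qed.

Lemma moment2_ge0 v n : 0 <= moment2 v n.
Proof. by apply: sumr_ge0 => w _; rewrite mulr_ge0 ?sqr_ge0 ?pr_ge0. Qed.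

Lemma moment2_le v n m : (level v <= n)%N -> (n <= m)%N ->
  moment2 v m <= moment2 v n.
Proof.
move=> vn nm; rewrite -subr_ge0 -variance_increment //.
by apply: sumr_ge0 => w _; apply: sumr_ge0 => x _;
   rewrite mulr_ge0 ?sqr_ge0 ?pr_ge0.
Qed.

End Central.
End CentralMeasure.

(** * A zero-one law and convergence in mean square *)

Lemma ae_eq0_integral0 d (T : measurableType d) (R : realType)
    (P : {measure set T -> \bar R}) (D : T -> R) :
  measurable_fun setT D -> (\int[P]_t (D t)%:E = 0)%E ->
  {ae P, forall t, 0 <= D t} -> {ae P, forall t, D t = 0}.
Proof.
move=> mD D0 Dge0; have mE : measurable_fun setT (EFin \o D) by
  exact/measurable_EFinP.
have : (\int[P]_t `|(EFin \o D) t| = 0)%E.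
  rewrite -[RHS]D0; apply: ae_eq_integral => //.
    exact: measurableT_comp.
  by apply: filterS Dge0 => t D0t _; rewrite /= ger0_norm.
move=> /(ae_eq_integral_abs _ measurableT mE); apply: filterS => t /(_ I).
by case.
Qed.

Section ZeroOneLimit.
Context d (T : measurableType d) (R : realType) (P : probability T R).
Variables (u : nat -> T -> R) (c : R).
Hypothesis mu : forall j, measurable_fun setT (u j).
Hypothesis u01 : forall j t, 0 <= u j t <= 1.
Hypothesis u_mean : forall j, (\int[P]_t (u j t)%:E = c%:E)%E.
Hypothesis u_incr : forall j,
  (\int[P]_t (`|u j t - u j.+1 t|)%:E <= (1 / (2 ^ j.+1)%:R)%:E)%E.

(** The increments are almost surely absolutely summable since the sum of their
    means is finite. *)
Lemma ae_cvg_summable_increments : {ae P, forall t, cvgn (u ^~ t)}.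
Proof.
pose dd j t : \bar R := (`|u j t - u j.+1 t|)%:E.
pose S t : \bar R := (\sum_(j <oo) dd j t)%E.
have md j : measurable_fun setT (dd j).
  apply/measurable_EFinP; apply: measurableT_comp => //.
  exact: measurable_funB.
have dd0 j t : (0 <= dd j t)%E by rewrite lee_fin.
have S0 t : (0 <= S t)%E by apply: nneseries_ge0 => j _ _; exact: dd0.
have mS : measurable_fun setT S.
  exact: (@ge0_emeasurable_sum _ _ _ _ _ predT).
have iS : P.-integrable setT S.
  apply/integrableP; split=> //.
  under eq_integral do rewrite gee0_abs //.
  rewrite integral_nneseries //.
  apply: le_lt_trans (ltry 1).
  apply: (le_trans _ (@epsilon_trick0 R 1 predT _)) => //.
  apply: lee_nneseries => [j _ _|j _]; first exact: integral_ge0.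
  exact: u_incr.
have := integrable_ae measurableT iS.
apply: filterS => t /(_ I) St.
have nE n : [normed series (telescope (u ^~ t))] n =
    \sum_(0 <= j < n) `|u j.+1 t - u j t| by [].
have cd : cvgn [normed series (telescope (u ^~ t))].
  apply: nondecreasing_is_cvgn.
    by apply/nondecreasing_seqP => n; rewrite !nE big_nat_recr //= lerDl.
  exists (fine (S t)) => _ [n _ <-]; rewrite -lee_fin fineK // nE.
  rewrite -sumEFin; apply: (le_trans _ (@nneseries_lim_ge _ _ predT 0 n _)) =>
    //.
  by apply: lee_sum => j _; rewrite /dd distrC.
have cs := normed_cvg cd.
rewrite (_ : u ^~ t = (fun n => u 0%N t + series (telescope (u ^~ t)) n)).
  by apply: is_cvgD => //; exact: is_cvg_cst.
by apply/funext => n; exact: (eq_sum_telescope (u ^~ t)).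
Qed.

Hypothesis zero_one : forall A : set T, measurable A ->
  (forall s t, (exists n, forall j, (n <= j)%N -> u j s = u j t) -> A s -> A t) ->
  P A = 0%E \/ P A = 1%E.

(** A bounded sequence with constant mean and summable increments, whose tail
    events are trivial, converges to its mean in mean square: its almost sure
    limit is measurable for the tail events, hence constant. *)
Lemma zero_one_cvg :
  (fun j => \int[P]_t ((u j t - c) ^+ 2)%:E)%E @ \oo --> 0%E.
Proof.
pose U t : \bar R := limn_esup (fun j => (u j t)%:E).
pose Z t : R := fine (U t).
have mU : measurable_fun setT U.
  by apply: measurable_fun_limn_esup => j; exact/measurable_EFinP.
have mZ : measurable_fun setT Z.
  by apply: measurableT_comp => //; exact: measurable_fine.
have uZ : {ae P, forall t, u ^~ t @ \oo --> Z t}.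
  move: ae_cvg_summable_increments; apply: filterS => t ct.
  have cE : (fun j => (u j t)%:E) @ \oo --> (limn (u ^~ t))%:E.
    exact: cvg_EFin (nearW _ _) ct.
  by rewrite /Z /U (cvg_limn_einf_sup cE).2.
have i1 : P.-integrable setT (EFin \o cst (1 : R)).
  exact: finite_measure_integrable_cst.
have [iZ _ intZ] : [/\ P.-integrable setT (EFin \o Z),
  [sequence (\int[P]_t `|(u n t)%:E - (Z t)%:E|)%E]_n @ \oo --> 0%E &
  [sequence (\int[P]_t (u n t)%:E)%E]_n @ \oo --> (\int[P]_t (Z t)%:E)%E].
  apply: (dominated_convergence measurableT _ _ _ i1).
  - by move=> n; exact/measurable_EFinP.
  - exact/measurable_EFinP.
  - apply: filterS uZ => t ut _; exact: cvg_EFin (nearW _ _) ut.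
  - apply: aeW => t n _ /=; rewrite lee_fin.
    by have /andP[u0 u1] := u01 n t; rewrite ger0_norm.
have EZ : (\int[P]_t (Z t)%:E = c%:E)%E.
  move: intZ; rewrite (_ : [sequence _]_n = cst c%:E); last first.
    by apply/funext => n; exact: u_mean.
  by move=> /cvg_lim <- //; rewrite lim_cst.
have ic : P.-integrable setT (EFin \o cst c).
  exact: finite_measure_integrable_cst.
(* The event that Z exceeds its mean c has probability 0 or 1; in either case
   Z - c has a constant sign almost surely, and its mean is 0. *)
have Zc : {ae P, forall t, Z t = c}.
  pose A := [set t | (c < Z t)%R].
  have mA : measurable A.
    rewrite (_ : A = setT `&` [set t | ((cst c) t < Z t)%R]);
      last by rewrite setTI.
    exact: (measurable_fun_ltr _ mZ measurableT).
  have tA s t : (exists n, forall j, (n <= j)%N -> u j s = u j t) -> A s -> A t.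
    move=> [n nst]; rewrite /A /=; suff -> : Z s = Z t by [].
    congr fine; rewrite /U !limn_esup_lim; congr lim.
    by apply/seteqP; split; apply: near_eq_cvg; exists n => // m /= nm;
      congr ereal_sup; apply/seteqP; split=> _ [l /= ml <-]; exists l => //;
      rewrite nst // (leq_trans nm).
  have mZc : measurable_fun setT (fun t => Z t - c) by exact: measurable_funB.
  have mcZ : measurable_fun setT (fun t => c - Z t) by exact: measurable_funB.
  have cE : (\int[P]_t (EFin \o cst c) t = c%:E)%E.
    rewrite -[RHS]mule1 -[in RHS](probability_setT P).
    exact: (integral_cst P measurableT c%:E).
  have [PA0|PA1] := zero_one mA tA.
    have : {ae P, forall t, 0 <= c - Z t}.
      exists A; split => // t /= /negP; rewrite subr_ge0 -ltNge; exact.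
    move=> /(ae_eq0_integral0 mcZ) H; have : {ae P, forall t, c - Z t = 0}.
      apply: H; under eq_integral do rewrite EFinB.
      by rewrite (integralB measurableT ic iZ) EZ cE subee.
    by apply: filterS => t /eqP; rewrite subr_eq0 => /eqP.
  have : {ae P, forall t, 0 <= Z t - c}.
    exists (~` A); split => //; first exact: measurableC.
      by rewrite probability_setC // PA1 subee.
    by move=> t /= h At; apply: h; rewrite subr_ge0 ltW.
  move=> /(ae_eq0_integral0 mZc) H; have : {ae P, forall t, Z t - c = 0}.
    apply: H; under eq_integral do rewrite EFinB.
    by rewrite (integralB measurableT iZ ic) EZ cE subee.
  by apply: filterS => t /eqP; rewrite subr_eq0 => /eqP.
pose g : T -> \bar R := EFin \o cst ((1 + `|c|) ^+ 2).
have [_ _] : [/\ P.-integrable setT (cst 0%E : T -> \bar R),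
  [sequence (\int[P]_t `|((u n t - c) ^+ 2)%:E - cst 0 t|)%E]_n @ \oo --> 0%E &
  [sequence (\int[P]_t ((u n t - c) ^+ 2)%:E)%E]_n @ \oo -->
    (\int[P]_t cst 0 t)%E].
  apply: (dominated_convergence measurableT _ _ _
    (finite_measure_integrable_cst P ((1 + `|c|) ^+ 2) measurableT)).
  - move=> n; apply/measurable_EFinP; apply: measurable_funX.
    exact: measurable_funB.
  - by [].
  - apply: filterS2 uZ Zc => t ut Ztc _; apply: cvg_EFin; first exact: nearW.
    rewrite /= -[X in _ --> X](_ : (Z t - c) ^+ 2 = 0); last first.
      by rewrite Ztc subrr expr0n.
    rewrite expr2; under eq_cvg do rewrite /= expr2.
    by apply: cvgM; apply: cvgB => //; exact: cvg_cst.
  - apply: aeW => t n _ /=; rewrite lee_fin normrX lerXn2r ?nnegrE ?addr_ge0 //.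
    apply: (le_trans (ler_normB _ _)); rewrite lerD2r.
    by have /andP[u0 u1] := u01 n t; rewrite ger0_norm.
by rewrite integral0.
Qed.

End ZeroOneLimit.

(** * Concentration of the conditional probabilities *)

Section Concentration.
Variables (G : gradedGraph) (R : realType) (P : probability (path_space G) R).
Implicit Types (u v w x : G).

Local Notation pr A := (fine (P A)).
Local Notation mble A := (@measurable _ (path_space G) A).

Lemma integral_finite_partition (I : eqType) (s : seq I)
    (A : I -> set (path_space G)) (a : I -> R) (f : path_space G -> R) :
  (forall i, measurable (A i)) ->
  (forall t, f t = \sum_(i <- s) a i * \1_(A i) t) ->
  (\int[P]_t (f t)%:E = (\sum_(i <- s) a i * pr (A i))%:E)%E.
Proof.
move=> mA fE.
have iA i : P.-integrable setT (fun t => (\1_(A i) t)%:E).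
  exact: integrable_indic.
under eq_integral do rewrite fE -sumEFin.
rewrite integral_sum // -?sumEFin => [|i]; last first.
  under eq_fun do rewrite EFinM.
  exact: integrableZl.
apply: eq_bigr => i _; under eq_integral do rewrite EFinM.
by rewrite integralZl // integral_indic // setIT EFinM prE.
Qed.

Lemma sum_indic_cylinder (t : path_space G) n (a : G -> R) :
  a (t n) = \sum_(w <- levelseq G n) a w * \1_(cylinder w) t.
Proof.
rewrite (bigD1_seq (t n)) ?levelseq_uniq ?mem_levelseq_infpath //=.
rewrite indicE mem_set ?mulr1; last by rewrite /cylinder /= level_infpath.
rewrite big_seq_cond big1 ?addr0 // => w /andP[].
rewrite mem_levelseq => /eqP wn wt.
rewrite indicE memNset ?mulr0 // /cylinder /= wn => tw.
by rewrite tw eqxx in wt.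
Qed.

Lemma integral_level n (a : G -> R) :
  (\int[P]_t (a (t n))%:E =
   (\sum_(w <- levelseq G n) a w * pr (cylinder w))%:E)%E.
Proof.
apply: integral_finite_partition => [w|t]; first exact: measurable_cylinder.
exact: sum_indic_cylinder.
Qed.

Lemma integral_level2 n m (h : G -> G -> R) :
  (\int[P]_t (h (t n) (t m))%:E =
   (\sum_(w <- levelseq G n) \sum_(x <- levelseq G m)
      h w x * pr (cylinder w `&` cylinder x))%:E)%E.
Proof.
rewrite (@integral_finite_partition _
  (allpairs pair (levelseq G n) (levelseq G m))
  (fun wx => cylinder wx.1 `&` cylinder wx.2) (fun wx => h wx.1 wx.2)).
- by rewrite big_allpairs.
- by move=> wx; apply: measurableI; exact: measurable_cylinder.
move=> t; rewrite big_allpairs /=.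
rewrite (sum_indic_cylinder t n (fun w => h w (t m))); apply: eq_bigr => w _.
rewrite (sum_indic_cylinder t m (h w)) mulr_suml; apply: eq_bigr => x _.
by rewrite indicI /= -mulrA (mulrC (\1_ _ t)).
Qed.

Hypotheses (cP : central P) (eP : ergodic P).

Lemma measurable_level n (a : G -> R) :
  measurable_fun setT (fun t : path_space G => a (t n)).
Proof.
move=> _ B mB; rewrite setTI.
exact: future_measurable (future_coord (a @^-1` B) (leq0n n)).
Qed.

(** The second moment of the conditional probability of a passage through v
    given the future from level n on is eventually almost as small as the square
    of its mean: this is where ergodicity enters. *)
Lemma moment2_cvg v (eps : R) : 0 < eps ->
  exists n0, forall n, (n0 <= n)%N ->
    moment2 P v n - pr (cylinder v) ^+ 2 <= eps.
Proof.
move=> eps0; set c := pr (cylinder v).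
pose a n := moment2 P v (level v + n).
have a_ni : nonincreasing_seq a.
  by move=> n m nm; apply: moment2_le => //; rewrite ?leq_addr ?leq_add2l.
have a_lb : has_lbound (range a) by exists 0 => _ [n _ <-]; exact: moment2_ge0.
pose L := inf (range a).
have aL n : L <= a n by apply: ge_inf => //; exists n.
have acvg : a @ \oo --> L by exact: nonincreasing_cvgn.
pose e j : R := 1 / (2 ^ j.+1)%:R.
have e0 j : 0 < e j by rewrite divr_gt0 ?ltr0n ?expn_gt0.
have eS j : e j.+1 <= e j.
  by rewrite /e ler_pM2l // lef_pV2 ?posrE ?ltr0n ?expn_gt0 // ler_nat
    leq_exp2l.
(* Levels whose second moments are close enough to their limit L for the
   increments along them to be summable; they need not be monotone. *)
have /choice[nj njP] (j : nat) : exists n, (j <= n)%N /\ a n - L <= e j ^+ 2.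
  have e20 : 0 < e j ^+ 2 by rewrite exprn_gt0.
  move/cvgrPdist_le : acvg => /(_ _ e20) [N _ hN].
  exists (maxn j N); split; first exact: leq_maxl.
  have := hN (maxn j N) (leq_maxr _ _).
  by rewrite distrC => /(le_trans (ler_norm _)).
pose l j := (level v + nj j)%N.
have vl j : (level v <= l j)%N by exact: leq_addr.
have lj j : (j <= l j)%N by rewrite (leq_trans (njP j).1) // leq_addl.
pose u j (t : path_space G) := cprob P v (t (l j)).
have mdiff j : moment2 P v (l j) - L <= e j ^+ 2 by exact: (njP j).2.
have Ll j : L <= moment2 P v (l j) by exact: aL.
(* |y| <= (e + y ^ 2 / e) / 2 bounds the mean of |y| by the mean of y ^ 2. *)
have u_incr j : (\int[P]_t (`|u j t - u j.+1 t|)%:E <= (e j)%:E)%E.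
  rewrite /u (integral_level2 _ _ (fun w x => `|cprob P v w - cprob P v x|)).
  rewrite lee_fin.
  pose S := \sum_(w <- levelseq G (l j)) \sum_(x <- levelseq G (l j.+1))
     (cprob P v w - cprob P v x) ^+ 2 * pr (cylinder w `&` cylinder x).
  have S1 : \sum_(w <- levelseq G (l j)) \sum_(x <- levelseq G (l j.+1))
      pr (cylinder w `&` cylinder x) = 1.
    under eq_bigr => w _ do rewrite (pr_level P _ (measurable_cylinder w)).
    rewrite -(prT P) -(@pr_level _ _ P (l j) setT) //.
    by apply: eq_bigr => w _; rewrite setTI.
  have Se : S <= e j ^+ 2.
    have eSj : e j.+1 ^+ 2 <= e j ^+ 2 by rewrite ler_pXn2r ?nnegrE ?eS
      ?(ltW (e0 _)).
    have [jj|jj] := leqP (l j) (l j.+1).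
      rewrite /S variance_increment //.
      by apply: le_trans (mdiff j); rewrite lerD2l lerN2.
    (* The levels come in the reverse order. *)
    rewrite /S exchange_big /=.
    under eq_bigr => x _ do under eq_bigr => w _ do
      rewrite -sqrrN opprB setIC.
    rewrite variance_increment ?(ltnW jj) //.
    by apply: le_trans eSj; apply: le_trans (mdiff j.+1); rewrite lerD2l lerN2.
  apply: (@le_trans _ _ ((e j + S / e j) / 2)); last first.
    by rewrite ler_pdivrMr // mulr_natr mulr2n lerD2l ler_pdivrMr.
  have -> : (e j + S / e j) / 2 = e j / 2 *
      (\sum_(w <- levelseq G (l j)) \sum_(x <- levelseq G (l j.+1))
      pr (cylinder w `&` cylinder x)) + (e j)^-1 / 2 * S.
    by rewrite S1; ring.
  rewrite /S !mulr_sumr -big_split; apply: ler_sum => w _ /=.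
  rewrite !mulr_sumr -big_split; apply: ler_sum => x _ /=.
  set q := pr _; set y := cprob P v w - cprob P v x.
  have -> : e j / 2 * q + (e j)^-1 / 2 * (y ^+ 2 * q) =
      (e j + y ^+ 2 / e j) / 2 * q by ring.
  rewrite ler_wpM2r ?pr_ge0 // ler_pdivlMr // -subr_ge0.
  have -> : e j + y ^+ 2 / e j - `|y| * 2 = (e j - `|y|) ^+ 2 / e j.
    by rewrite -real_normK ?num_real //; field; rewrite gt_eqF.
  by rewrite divr_ge0 ?sqr_ge0 ?(ltW (e0 _)).
have mean j : (\int[P]_t (u j t)%:E = c%:E)%E.
  by rewrite /u integral_level moment1E.
have := @zero_one_cvg _ _ _ P u c (fun j => measurable_level (l j) (cprob P v))
   _ mean u_incr _.
have -> : (fun j => (\int[P]_t ((u j t - c) ^+ 2)%:E)%E) =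
    EFin \o (fun j => moment2 P v (l j) - c ^+ 2).
  apply/funext => j /=.
  rewrite /u (integral_level _ (fun w => (cprob P v w - c) ^+ 2)).
  by congr _%:E; rewrite variance_const //; rewrite -/c; ring.
move=> H; have /fine_cvgP[_ {}H] :
    EFin \o (fun j => moment2 P v (l j) - c ^+ 2) @ \oo --> 0%:E.
  apply: H => [j t|A mA tA].
    by rewrite cprob_ge0 cprob_le1.
  apply: eP => // s t [n st]; apply: tA; exists n => j nj'.
  by rewrite /u st // (leq_trans nj').
move/cvgrPdist_le : H => /(_ _ eps0) [N _ hN].
exists (l N) => n ln; have := hN N (leqnn N); rewrite sub0r normrN.
move=> /(le_trans (ler_norm _)); apply: le_trans.
by rewrite lerD2r moment2_le.
Qed.

(** Some vertex w of arbitrarily high level is such that the conditional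
    probabilities of passages through the vertices of a given finite set,
    given the passage through w, are close to the probabilities of these
    passages. *)
Lemma cprob_approx (vs : seq G) (eps : R) N : 0 < eps ->
  exists w, [/\ (N <= level w)%N, pr (cylinder w) != 0 &
    forall v, v \in vs -> `|cprob P v w - pr (cylinder v)| <= eps].
Proof.
move=> eps0; pose dl : R := eps ^+ 2 / (2 * (size vs).+1%:R).
have dl0 : 0 < dl by rewrite divr_gt0 ?exprn_gt0 ?mulr_gt0.
have [n nP] : exists n, (N <= n)%N /\ forall v, v \in vs ->
    (level v <= n)%N /\ moment2 P v n - pr (cylinder v) ^+ 2 <= dl.
  elim: vs {eps0} dl dl0 => [|v vs IH] dl dl0; first by exists N.
  have [n [Nn hn]] := IH _ dl0; have [n0 hn0] := moment2_cvg v dl0.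
  pose n' := maxn n (maxn n0 (level v)).
  have nn' : (n <= n')%N by rewrite leq_maxl.
  exists n'; split; first exact: leq_trans nn'.
  move=> x; rewrite inE => /orP[/eqP ->|/hn[xn hx]].
    by split; [rewrite !leq_max leqnn !orbT|apply: hn0;
      rewrite !leq_max leqnn !orbT].
  split; first exact: leq_trans nn'.
  by apply: le_trans hx; rewrite lerD2r moment2_le.
pose f w := \sum_(v <- vs) (cprob P v w - pr (cylinder v)) ^+ 2.
have f0 w : 0 <= f w by apply: sumr_ge0 => v _; exact: sqr_ge0.
have Ef : \sum_(w <- levelseq G n) f w * pr (cylinder w) < eps ^+ 2.
  under eq_bigr => w _ do rewrite mulr_suml.
  rewrite exchange_big /= big_seq.
  apply: (@le_lt_trans _ _ (\sum_(v <- vs | v \in vs) dl)).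
    apply: ler_sum => v /nP.2[vn hv]; apply: le_trans hv.
    by rewrite variance_const // le_eqVlt; apply/orP; left; apply/eqP; ring.
  rewrite -big_seq big_const_seq count_predT iter_addr_0 -mulr_natr /dl.
  rewrite mulrAC ltr_pdivrMr ?mulr_gt0 // ltr_pM2l ?exprn_gt0 //.
  by rewrite mulr_natl mulr2n -natrD ltr_nat ltn_addr // ltnSn.
have [w wn [w0 fw]] : exists2 w, w \in levelseq G n &
    pr (cylinder w) != 0 /\ f w <= eps ^+ 2.
  apply: contrapT => H; move: Ef; apply/negP; rewrite -leNgt.
  have <- : \sum_(w <- levelseq G n) eps ^+ 2 * pr (cylinder w) = eps ^+ 2.
    rewrite -mulr_sumr -[RHS]mulr1; congr (_ * _).
    rewrite -(prT P) -(@pr_level _ _ P n setT) //.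
    by apply: eq_bigr => w _; rewrite setTI.
  rewrite big_seq [leRHS]big_seq; apply: ler_sum => w wn.
  have [->|w0] := eqVneq (pr (cylinder w)) 0; first by rewrite !mulr0.
  rewrite ler_wpM2r ?pr_ge0 // leNgt; apply/negP => fw; apply: H.
  by exists w => //; split=> //; exact: ltW.
exists w; split=> //.
  by move: wn; rewrite mem_levelseq => /eqP ->; exact: nP.1.
move=> v vvs; rewrite -(@ler_pXn2r _ 2) ?nnegrE ?(ltW eps0) //.
apply: le_trans fw; rewrite real_normK ?num_real // /f.
rewrite (big_rem v) //= lerDl; apply: sumr_ge0 => x _; exact: sqr_ge0.
Qed.

End Concentration.

(** * Counting paths between diagrams with at most k rows *)

Lemma notin0_nth (s : seq nat) i : 0%N \notin s -> (i < size s)%N ->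
  (0 < nth 0 s i)%N.
Proof.
by move=> s0 si; rewrite lt0n; apply: contraNneq s0 => <-; exact: mem_nth.
Qed.

Lemma eq_nth0_seq (s t : seq nat) : 0%N \notin s -> 0%N \notin t ->
  nth 0%N s =1 nth 0%N t -> s = t.
Proof.
move=> s0 t0 st; apply: (@eq_from_nth _ 0%N) => [|i _]; last exact: st.
apply/eqP; rewrite eqn_leq; apply/andP; split; rewrite leqNgt; apply/negP => lt.
  by have := notin0_nth s0 lt; rewrite st nth_default.
by have := notin0_nth t0 lt; rewrite -st nth_default.
Qed.

Lemma diagram_nonincr (la : diagram) i : (nth 0 la i.+1 <= nth 0 la i)%N.
Proof.
have /andP[sl _] := rowsP la.
have [js|js] := ltnP i.+1 (size la); last by rewrite nth_default.
exact: (sortedP 0%N sl).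
Qed.

Lemma diagram_nonincrW (la : diagram) i j : (i <= j)%N ->
  (nth 0 la j <= nth 0 la i)%N.
Proof.
move=> /subnK <-; elim: (j - i)%N => // d IH; rewrite addSn.
exact: leq_trans (diagram_nonincr _ _) IH.
Qed.

Lemma diagram_eq (la mu : diagram) : nth 0%N la =1 nth 0%N mu -> la = mu.
Proof.
have /andP[_ la0] := rowsP la; have /andP[_ mu0] := rowsP mu.
by move=> e; exact/val_inj/eq_nth0_seq.
Qed.

(** Adding a cell increments one row length. *)
Lemma add_cellP (la mu : diagram) : reflect
  (exists r : nat, forall j : nat, nth 0 mu j = ((r == j) + nth 0 la j)%N)
  (add_cell la mu).
Proof.
have /andP[_ la0] := rowsP la; have /andP[_ mu0] := rowsP mu.
apply: (iffP existsP) => [[i /eqP e]|[r e]].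
  by exists (i : nat) => j; rewrite e nth_incr_nth.
have rla : (r < (size la).+1)%N.
  rewrite ltnS leqNgt; apply/negP => lt.
  have := diagram_nonincrW mu (ltnW lt); rewrite !e eqxx.
  by rewrite [nth 0 la (size la)]nth_default // (gtn_eqF lt).
exists (Ordinal rla); apply/eqP; apply: eq_nth0_seq => // [|j]; last first.
  by rewrite nth_incr_nth e.
apply/negP => /(nthP 0%N)[j]; rewrite size_incr_nth nth_incr_nth /= => js.
have [//|rj] := eqVneq r j; rewrite add0n => j0.
have : (j < size la)%N.
  move: js; case: ifP => // /negbT; rewrite -leqNgt => lar.
  by rewrite ltnS leq_eqVlt eq_sym (negPf rj) /= => /leq_trans; apply.
by move=> /(notin0_nth la0); rewrite j0.
Qed.

(** The diagram with given weakly decreasing row lengths that vanish from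
    index k on. *)
Section MakeDiagram.
Variables (f : nat -> nat) (k : nat).
Hypotheses (f_nonincr : forall i, (f i.+1 <= f i)%N)
  (fk : forall i, (k <= i)%N -> f i = 0%N).

Let len := find (fun j => f j == 0%N) (iota 0 k).

Let len_le : (len <= k)%N.
Proof. by rewrite (leq_trans (find_size _ _)) // size_iota. Qed.

Let f0 i : (len <= i)%N -> f i = 0%N.
Proof.
move=> li; have f0 : f len = 0%N.
  have [lk|lk] := ltnP len k; last exact: fk.
  have := nth_find 0%N (a := fun j => f j == 0%N) (s := iota 0 k).
  by rewrite has_find size_iota => /(_ lk); rewrite nth_iota // => /eqP.
rewrite -(subnK li); elim: (i - len)%N => [//|d IH].
by apply/eqP; rewrite addSn -leqn0 (leq_trans (f_nonincr _)) // IH.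
Qed.

Let fpos i : (i < len)%N -> (0 < f i)%N.
Proof.
move=> il; have := before_find 0%N il; rewrite nth_iota ?(leq_trans il) //
  add0n.
by rewrite lt0n => ->.
Qed.

Fact make_rowsP : sorted geq (mkseq f len) && (0%N \notin mkseq f len).
Proof.
apply/andP; split.
  apply/(sortedP 0%N) => i; rewrite size_mkseq => il.
  by rewrite !nth_mkseq ?(ltnW il) //=; exact: f_nonincr.
by apply/negP => /mapP[i]; rewrite mem_iota /= => /fpos; case: (f i).
Qed.

Definition make_diagram : diagram := Diagram make_rowsP.

Lemma nth_make_diagram i : nth 0%N make_diagram i = f i.
Proof.
have [il|il] := ltnP i len; first by rewrite nth_mkseq.
by rewrite nth_default ?size_mkseq // f0.
Qed.

Lemma size_make_diagram : (size make_diagram <= k)%N.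
Proof. by rewrite size_mkseq. Qed.

End MakeDiagram.

Section Determinants.
Variable R : realType.

(** The entries of row r alone being multiplied by the x_r - y_j, the sum over r
    of the determinants is a multiple of the original one: the factors
    x_r - y_(s r) in the term of a permutation s add up to a number independent
    of s. *)
Lemma det_euler n (x y : 'I_n -> R) (A : 'I_n -> 'I_n -> R) :
  \sum_r \det (\matrix_(i, j) ((if i == r then x i - y j else 1) * A i j)) =
  (\sum_i x i - \sum_j y j) * \det (\matrix_(i, j) A i j).
Proof.
rewrite /determinant exchange_big /= mulr_sumr; apply: eq_bigr => s _.
rewrite mulrCA -mulr_sumr; congr (_ * _).
rewrite [\sum_j y j](reindex_inj (@perm_inj _ s)) -sumrB mulr_suml.
apply: eq_bigr => r _.
under eq_bigr do rewrite mxE.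
rewrite big_split /= (bigD1 r) //= eqxx big1 ?mulr1 => [|i /negPf -> //].
by congr (_ * _); apply: eq_bigr => i _; rewrite mxE.
Qed.

(** The quotient of the falling factorial of l of length a by l!, that is
    1 / (l - a)! if a <= l and 0 otherwise. *)
Definition ffq (l a : nat) : R := ffpow 1 a l%:R / l`!%:R.

Lemma ffpow1_nat (l a : nat) : ffpow 1 a l%:R = (l ^_ a)%:R :> R.
Proof.
elim: a => [|a IH]; first by rewrite ffpow0.
rewrite ffpowS IH ffactnSr natrM mulr1; have [al|al] := leqP a l.
  by rewrite natrB.
by rewrite ffact_small ?mul0r.
Qed.

Lemma fact_neq0 l : l`!%:R != 0 :> R.
Proof. by rewrite pnatr_eq0 -lt0n fact_gt0. Qed.

Lemma ffq_small l a : (l < a)%N -> ffq l a = 0.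
Proof. by move=> la; rewrite /ffq ffpow1_nat ffact_small ?mul0r. Qed.

Lemma ffqq l : ffq l l = 1.
Proof. by rewrite /ffq ffpow1_nat ffactnn mulfV // fact_neq0. Qed.

Lemma ffq_pred l a : (0 < l)%N -> ffq l.-1 a = (l%:R - a%:R) * ffq l a.
Proof.
case: l => // l _; rewrite /ffq !ffpow1_nat factS /=.
have E : (l.+1%:R - a%:R) * (l.+1 ^_ a)%:R = (l.+1 * l ^_ a)%:R :> R.
  rewrite -ffactnS ffactnSr natrM; have [al|al] := leqP a l.+1.
    by rewrite natrB // mulrC.
  by rewrite ffact_small // mul0r mulr0.
rewrite mulrA E !natrM; field.
by rewrite fact_neq0 nat1r pnatr_eq0.
Qed.

Lemma ffq0 a : (0 - a%:R) * ffq 0 a = 0.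
Proof. by case: a => [|a]; rewrite ?subrr ?mul0r // ffq_small // mulr0. Qed.

Lemma det_row0 n (A : 'M[R]_n) r : (forall j, A r j = 0) -> \det A = 0.
Proof.
by move=> A0; rewrite (expand_det_row A r) big1 // => j _; rewrite A0 mul0r.
Qed.

(** A square matrix of order n with a vanishing block whose numbers of rows
    and columns add up to n + 1 is singular. *)
Lemma det_zero_block n (A : 'M[R]_n) (r : 'I_n) :
  (forall i j : 'I_n, (r <= i)%N -> (j <= r)%N -> A i j = 0) -> \det A = 0.
Proof.
move=> A0; rewrite /determinant big1 // => s _.
suff [i ri sir] : exists2 i : 'I_n, (r <= i)%N & (s i <= r)%N.
  by rewrite (bigD1 i) //= A0 // mul0r mulr0.
apply: contrapT => H; pose B := [pred i : 'I_n | (r <= i)%N].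
have : (#|[seq s i | i in B]| <= #|[predD1 B & r]|)%N.
  apply/subset_leq_card/fintype.subsetP => _ /fintype.imageP[i ri ->];
    rewrite !inE.
  have lt : (r < s i)%N by rewrite ltnNge; apply/negP => sir; apply: H;
    exists i.
  by rewrite -val_eqE /= (gtn_eqF lt) ltnW.
rewrite fintype.card_image; last exact: perm_inj.
by rewrite [X in (X <= _)%N](cardD1 r) inE /= leqnn ltnn.
Qed.

End Determinants.

Section YoungDimension.
Variables (k : nat) (k_gt0 : (0 < k)%N) (R : realType).
Local Notation Y := (young_rows k_gt0).
Implicit Types v w x : Y.

(** The row lengths of v, continued by zeros. *)
Definition rowlen v (i : nat) : nat := nth 0%N (rows (val v)) i.

Lemma row_nonincr v i : (rowlen v i.+1 <= rowlen v i)%N.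
Proof. exact: diagram_nonincr. Qed.

Lemma row_ge v i : (k <= i)%N -> rowlen v i = 0%N.
Proof. by move=> ki; rewrite /rowlen nth_default // (leq_trans (valP v)). Qed.

Lemma row_inj v w : (forall i, (i < k)%N -> rowlen v i = rowlen w i) -> v = w.
Proof.
move=> e; apply/val_inj/diagram_eq => i.
by have [ik|ik] := ltnP i k; [exact: e|rewrite -!/(rowlen _ _) !row_ge].
Qed.

Lemma level_row v : level v = (\sum_(i < k) rowlen v i)%N.
Proof.
rewrite [LHS]sumnE (big_nth 0%N) /= (big_nat_widen _ _ _ _ _ (valP v))
  big_mkord.
rewrite big_mkcond; apply: eq_bigr => i _ /=; case: ltnP => // h.
by rewrite /rowlen nth_default.
Qed.

Lemma row_source : rowlen (source Y) = fun=> 0%N.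
Proof. by apply/funext => i; rewrite /rowlen nth_nil. Qed.

(** A cell of row r can be removed from w. *)
Definition removable w (r : nat) : bool := (rowlen w r.+1 < rowlen w r)%N.

Fact lower_nonincr w r : removable w r ->
  forall i, (rowlen w i.+1 - (i.+1 == r) <= rowlen w i - (i == r))%N.
Proof.
rewrite /removable => h i; have := row_nonincr w i.
case: (i == r) / eqP => [e|_]; last by lia.
by subst r; lia.
Qed.

Fact lower_ge w r i : (k <= i)%N -> (rowlen w i - (i == r) = 0)%N.
Proof. by move=> ki; rewrite row_ge. Qed.

(** The diagram w with a cell of row r removed. *)
Definition lower w r : Y :=
  if @idP (removable w r) is ReflectT h then
    exist _ (make_diagram k (lower_nonincr h))
      (size_make_diagram k (lower_nonincr h))
  else w.

Lemma row_lower w r i : removable w r -> rowlen (lower w r) i =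
  (rowlen w i - (i == r))%N.
Proof.
rewrite /lower; case: {-}_ / idP => // h _.
exact: (nth_make_diagram (lower_nonincr h) (@lower_ge w r)).
Qed.

Lemma edgeP x w : edge x w <-> exists r, removable w r /\ x = lower w r.
Proof.
split.
  move=> /add_cellP[r e]; exists r.
  have e' j : rowlen w j = ((r == j) + rowlen x j)%N by exact: e.
  have rw : removable w r.
    by rewrite /removable !e' eqxx (ltn_eqF (ltnSn r)) ltnS row_nonincr.
  split=> //; apply: row_inj => i _; rewrite row_lower // e' eq_sym.
  by rewrite addKn.
move=> [r [rw ->]]; apply/add_cellP; exists r => j.
rewrite -/(rowlen w j) -/(rowlen (lower w r) j) row_lower // eq_sym subnKC //.
by case: eqP => [->|//]; exact: leq_ltn_trans rw.
Qed.

Lemma sum_edge (F : Y -> R) w :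
  \sum_(x <- levelseq Y (level w).-1 | edge x w) F x =
  \sum_(r < k | removable w r) F (lower w r).
Proof.
rewrite -big_filter -[RHS]big_filter -(big_map (fun r : 'I_k => lower w r)
  predT).
apply: perm_big; apply: uniq_perm.
- by rewrite filter_uniq // levelseq_uniq.
- rewrite map_inj_in_uniq; first by rewrite filter_uniq // index_enum_uniq.
  move=> r q; rewrite !mem_filter => /andP[rw _] /andP[qw _] e.
  apply/val_inj/eqP; have := congr1 (rowlen ^~ r) e;
    rewrite /= !row_lower // eqxx.
  by case: eqVneq => // _; move: rw; rewrite /removable; lia.
move=> x; rewrite mem_filter mem_levelseq; apply/andP/mapP.
  move=> [/edgeP[r [rw ->]] _]; have rk : (r < k)%N.
    by rewrite ltnNge; apply: contraTN rw => kr;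
      rewrite /removable (row_ge _ kr).
  exists (Ordinal rk) => //.
  by rewrite mem_filter rw mem_index_enum.
move=> [r]; rewrite mem_filter => /andP[rw _] ->.
have xw : edge (lower w r) w by apply/edgeP; exists r.
by split=> //; rewrite (edge_level xw).
Qed.

(** The row lengths shifted by k - 1, ..., 1, 0, which strictly decrease. *)
Definition srow w (i : nat) : nat := (rowlen w i + (k - i.+1))%N.

Lemma srow_decr w i j : (i < j)%N -> (j < k)%N -> (srow w j < srow w i)%N.
Proof.
move=> ij jk; rewrite /srow -addnS leq_add //.
  exact: diagram_nonincrW (ltnW ij).
by lia.
Qed.

Lemma sum_srow v w : \sum_(i < k) (srow w i)%:R - \sum_(i < k) (srow v i)%:R
  = (level w)%:R - (level v)%:R :> R.
Proof.
rewrite !level_row !natr_sum /srow -!sumrB; apply: eq_bigr => i _.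
by rewrite !natrD; ring.
Qed.

(** The determinant of the numbers 1 / (l_i - a_j)!, read as 0 when l_i < a_j,
    where l and a are the shifted row lengths of w and v. *)
Definition skewdet v w : R :=
  \det (\matrix_(i < k, j < k) ffq R (srow w i) (srow v j)).

(** This is [det_euler] with the terms of the rows that cannot be shortened left
    out: their determinants have a zero row or two equal rows. *)
Lemma skewdet_rec v w : \sum_(r < k | removable w r) skewdet v (lower w r) =
  ((level w)%:R - (level v)%:R) * skewdet v w.
Proof.
rewrite -sum_srow -det_euler [RHS](bigID (fun r : 'I_k => removable w r)) /=
  [X in _ + X]big1 ?addr0.
  apply: eq_bigr => r rw; congr (\det _); apply/matrixP => i j; rewrite !mxE.
  rewrite /srow row_lower // val_eqE; case: eqVneq => [->|_].
    have r0 : (0 < rowlen w r)%N by exact: leq_ltn_trans rw.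
    rewrite -ffq_pred; last by rewrite addn_gt0 r0.
    by congr (ffq R _ _); lia.
  by rewrite subn0 mul1r.
move=> r; rewrite /removable -leqNgt => rw.
have {rw} rE : rowlen w r = rowlen w r.+1.
  by apply/eqP; rewrite eqn_leq rw row_nonincr.
have [rk|rk] := ltnP r.+1 k; last first.
  apply: (@det_row0 _ _ _ r) => j; rewrite mxE eqxx.
  have -> : srow w r = 0%N.
    by rewrite /srow rE row_ge // add0n; apply/eqP; rewrite subn_eq0.
  exact: ffq0.
apply: (@determinant_alternate _ _ _ r (Ordinal rk)) => [|j].
  by rewrite -val_eqE /= neq_ltn ltnSn.
rewrite !mxE eqxx -val_eqE /= (gtn_eqF (ltnSn _)) mul1r -ffq_pred /=.
  by congr (ffq R _ _); rewrite /srow rE; lia.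
by rewrite /srow addn_gt0 subn_gt0 rk orbT.
Qed.

Lemma skewdet_level v w : level v = level w -> skewdet v w = (w == v)%:R.
Proof.
move=> vw; have [->|wv] := eqVneq w v.
  rewrite /skewdet -det_tr det_trig.
    by apply: big1 => i _; rewrite !mxE ffqq.
  apply/is_trig_mxP => i j ij; rewrite !mxE ffq_small //.
  exact: srow_decr.
have [i lt] : exists i : 'I_k, (rowlen w i < rowlen v i)%N.
  apply: contrapT => H.
  have le (i : 'I_k) : (rowlen v i <= rowlen w i)%N.
    by rewrite leqNgt; apply/negP => lt; apply: H; exists i.
  move/negP: wv; apply; apply/eqP; apply: row_inj => i ik.
  have /eqP : (\sum_(i < k) (rowlen w i - rowlen v i) = 0)%N.
    by rewrite sumnB // -!level_row vw subnn.
  rewrite sum_nat_eq0 => /forallP/(_ (Ordinal ik)) /=; rewrite subn_eq0 => wvi.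
  by apply/eqP; rewrite eqn_leq wvi (le (Ordinal ik)).
rewrite /skewdet (@det_zero_block _ _ _ i) // => j l ij li.
rewrite mxE ffq_small //.
apply: (@leq_ltn_trans (srow w i)).
  by move: ij; rewrite leq_eqVlt => /orP[/eqP ->//|/srow_decr H];
    rewrite ltnW // H.
apply: (@leq_trans (srow v i)); first by rewrite /srow ltn_add2r.
by move: li; rewrite leq_eqVlt => /orP[/eqP ->//|/srow_decr H];
  rewrite ltnW // H.
Qed.

(** The determinantal formula for the number of standard skew tableaux. *)
Lemma npath_skewdet v i w : level w = (level v + i)%N ->
  (npath v i w)%:R = i`!%:R * skewdet v w.
Proof.
elim: i w => [|i IH] w wi /=.
  by rewrite fact0 mul1r skewdet_level // wi addn0.
have E : \sum_(x <- levelseq Y (level w).-1 | edge x w) (npath v i x)%:R =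
    \sum_(x <- levelseq Y (level w).-1 | edge x w) i`!%:R * skewdet v x.
  rewrite big_seq_cond [RHS]big_seq_cond; apply: eq_bigr => x /andP[].
  by rewrite mem_levelseq => /eqP xl _; apply: IH; rewrite xl wi addnS.
rewrite natr_sum E -mulr_sumr sum_edge skewdet_rec wi factS natrM natrD.
ring.
Qed.

Lemma prod_fact_neq0 w : \prod_(i < k) (srow w i)`!%:R != 0 :> R.
Proof. by apply/prodf_neq0 => i _; exact: fact_neq0. Qed.

Lemma ffpow_scale (th c : R) a (x : R) : ffpow (c * th) a (c * x) = c ^+ a *
  ffpow th a x.
Proof.
elim: a => [|a IH]; first by rewrite !ffpow0 mulr1.
by rewrite !ffpowS IH exprSr; ring.
Qed.

Lemma shape_row N v : (level v < N)%N -> row_shape k N (rowlen v).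
Proof.
move=> vN; split=> j jk; first exact: row_nonincr.
apply: leq_ltn_trans vN; rewrite level_row.
by rewrite (bigD1 (Ordinal jk)) //= leq_addr.
Qed.

Lemma skewdet_fschur N v w (c : R) : c != 0 -> (level v < N)%N ->
  skewdet v w * (\prod_(i < k) (srow w i)`!%:R) =
  c ^+ (\sum_(j < k) srow v j) *
  (vander k (fun i => (srow w i)%:R / c) *
   fschur N c^-1 k (rowlen v) (fun i => (srow w i)%:R / c)).
Proof.
move=> c0 vN; rewrite -(det_altmx _ _ (shape_row vN)) mulrC.
rewrite -det_scale_row -prodrXr -det_scale_col; congr (\det _).
apply/matrixP => i j; rewrite !mxE /ffq mulrC divfK ?fact_neq0 //.
by rewrite -ffpow_scale mulfV // [_ / c]mulrC mulVKf.
Qed.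

Lemma vander_srow_neq0 w (c : R) : c != 0 ->
  vander k (fun i => (srow w i)%:R / c) != 0.
Proof.
move=> c0; apply/prodf_neq0 => j _; apply/prodf_neq0 => i _.
rewrite -mulrBl mulf_neq0 ?invr_eq0 // subr_eq0 eqr_nat.
by rewrite gtn_eqF // srow_decr.
Qed.

Lemma pathdim_young w N (c : R) : c != 0 -> (0 < N)%N ->
  (pathdim w)%:R * (\prod_(i < k) (srow w i)`!%:R) = (level w)`!%:R *
    (c ^+ (\sum_(j < k) srow (source Y) j) * vander k (fun i => (srow w i)%:R /
      c)).
Proof.
move=> c0 N0; rewrite -npath_source npath_skewdet // -mulrA.
rewrite (@skewdet_fschur N _ _ c) // row_source fschur_empty //.
by rewrite mulr1.
Qed.

Lemma pathdim_young_neq0 w : (pathdim w)%:R != 0 :> R.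
Proof.
have := @pathdim_young w 1 1 (oner_neq0 _) isT; apply: contra_eq_neq => ->.
rewrite mul0r eq_sym mulf_neq0 ?fact_neq0 // mulf_neq0 ?expf_neq0 ?oner_neq0 //.
by apply: vander_srow_neq0; exact: oner_neq0.
Qed.

(** The ratio of the number of paths from v to w to the number of all paths to w
    is, up to a factor depending only on the levels, a factorial Schur function of
    the shifted row lengths of w divided by the level of w. *)
Theorem npath_fschur N v w (n := level w) : (0 < n)%N -> (level v <= n)%N ->
  (level v < N)%N ->
  (npath v (n - level v) w)%:R / (pathdim w)%:R * ffpow n%:R^-1 (level v) 1 =
  fschur N n%:R^-1 k (rowlen v) (fun i => (srow w i)%:R / n%:R) :> R.
Proof.
move=> n0 vn vN; have c0 : n%:R != 0 :> R by rewrite pnatr_eq0 -lt0n.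
have pf := prod_fact_neq0 w; have dw := pathdim_young_neq0 w.
rewrite mulrAC; apply: (mulIf dw); rewrite divfK //.
apply: (mulIf pf); rewrite -[RHS]mulrA.
rewrite (pathdim_young _ c0 (leq_ltn_trans (leq0n _) vN)).
rewrite npath_skewdet ?subnKC // mulrAC -[_ * skewdet v w * _]mulrA.
rewrite (skewdet_fschur _ c0 vN) -/n.
set F := fschur _ _ _ _ _; set V := vander _ _.
have -> : (\sum_(j < k) srow v j = level v + \sum_(j < k) srow (source Y) j)%N.
  rewrite level_row -big_split; apply: eq_bigr => j _ /=.
  by rewrite /srow row_source.
have fE : (n - level v)`!%:R * (n%:R ^+ level v * ffpow n%:R^-1 (level v) 1) =
  n`!%:R :> R.
  rewrite -ffpow_scale mulfV // mulr1 ffpow1_nat -natrM mulnC.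
  by rewrite ffact_fact.
by rewrite -fE exprD; ring.
Qed.

End YoungDimension.

(** * The inclusion into the Young graph *)

(** The conditional probability of an initial path to v given the future can
    be taken to be the indicator of the passage through v divided by the number
    of paths to v. *)
Lemma central_initialP (G : gradedGraph) (R : realType)
    (P : probability (path_space G) R) :
  (forall v p B, finpaths v p -> future_events G (level v) B ->
    (pathdim v)%:R * fine (P (initial p `&` B)) = fine
      (P (cylinder v `&` B))) ->
  central P.
Proof.
move=> H v _; pose g (x : G) : R := (x == v)%:R / (pathdim v)%:R.
exists (fun t : path_space G => g (t (level v))) => p pv; split.
- by move=> B _; exact: (future_coord (g @^-1` B) (leqnn _)).
- apply: measurable_bounded_integrable => //.
  + by rewrite -ge0_fin_numE ?measure_ge0 ?fin_num_measure.
  + exact: measurable_level.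
  + exists ((pathdim v)%:R^-1); split; first exact: num_real.
    move=> M lM t _; rewrite /= /g; apply: le_trans (ltW lM).
    rewrite ger0_norm ?divr_ge0 //; case: (_ == _).
      by rewrite mul1r.
    by rewrite mul0r invr_ge0.
move=> B FB; have mB := future_measurable FB.
have mC := @measurable_cylinder G v.
have dv : (pathdim v)%:R != 0 :> R.
  rewrite pnatr_eq0 pathdimE size_eq0; apply/eqP => e.
  by move/mem_finpathseq : pv; rewrite e.
transitivity ((pathdim v)%:R^-1%:E * P (cylinder v `&` B))%E.
  rewrite -(setIC B) -[X in (_ * P X)%E]setIC -integral_indic // -integralZl //.
    apply: eq_integral => t _; rewrite -EFinM /g mulrC indicE.
    by congr (_ * _%:R)%:E; congr nat_of_bool; apply/eqP/idP; rewrite inE.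
  by apply: integrableS (integrable_indic _ mC) => //.
have mi : @measurable _ (path_space G) (initial p `&` B).
  by apply: measurableI => //; exact: measurable_initial.
have mCB : @measurable _ (path_space G) (cylinder v `&` B) by exact:
  measurableI.
rewrite -(prE P mi) -(prE P mCB) -EFinM; congr _%:E.
by rewrite -(H v p B) // mulKf.
Qed.

Section YoungRowsEmbedding.
Variables (k : nat) (k_gt0 : (0 < k)%N).
Local Notation Y := (young_rows k_gt0).
Implicit Types v w x : Y.

Lemma add_cell_size (la mu : diagram) : add_cell la mu ->
  (size la <= size mu)%N.
Proof.
case/existsP => i /eqP ->; rewrite size_incr_nth; case: ifP => // /negbT.
by rewrite -leqNgt => h; rewrite (leq_trans h).
Qed.

Lemma finpaths_val v q : finpaths v q -> finpaths (val v : young) (map val q).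
Proof.
move=> [pq <-]; split; last by rewrite (last_map val q (source Y)).
by rewrite -[source young]/(val (source Y)) path_map.
Qed.

(** A path to a diagram with at most k rows goes through such diagrams only. *)
Lemma finpaths_lift v p : finpaths (val v : young) p ->
  exists2 q, finpaths v q & map val q = p.
Proof.
elim/last_ind: p v => [|p y IH] v [].
  move=> _ /= sv; exists [::] => //; split=> //.
  exact: val_inj.
rewrite rcons_path last_rcons => /andP[pp py] yv; subst y.
have xk : (size (rows (last (source young) p)) <= k)%N.
  exact: leq_trans (add_cell_size py) (valP v).
pose x : Y := exist _ (last (source young) p) xk.
have [q xq qp] := IH x (conj pp erefl).
exists (rcons q v); last by rewrite map_rcons qp.
exact: (@finpaths_rcons Y x).
Qed.

Lemma pathdim_val v : pathdim (val v : young) = pathdim v.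
Proof.
rewrite !pathdimE -(size_map (map val) (finpathseq v)); apply: perm_size;
  apply: uniq_perm.
- exact: finpathseq_uniq.
- rewrite (map_inj_uniq (seq.inj_map val_inj)); exact: finpathseq_uniq.
move=> p; apply/idP/mapP => [/mem_finpathseq/finpaths_lift[q qv <-]|].
  by exists q => //; exact/mem_finpathseq.
by move=> [q qv ->]; apply/mem_finpathseq/finpaths_val/mem_finpathseq.
Qed.

Local Notation incl := (@young_rows_inclusion k k_gt0).

Lemma inclusion_cylinder v : incl @^-1` cylinder (val v : young) = cylinder v.
Proof.
apply/seteqP; split=> t; rewrite /cylinder /=; first exact: val_inj.
by move=> ->.
Qed.

Lemma inclusion_cylinder0 (la : young) : (k < size (rows la))%N ->
  incl @^-1` cylinder la = set0.
Proof.
move=> kla; rewrite -subset0 => t; rewrite /cylinder /= => tla.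
by move: kla; rewrite -tla ltnNge => /negP; apply; exact: (valP (t (sumn la))).
Qed.

Lemma inclusion_initial (q : seq Y) :
  incl @^-1` initial (map val q : seq young) = initial q.
Proof.
have E (t : infpath Y) : mkseq (fun i => val (t i.+1)) (size q) =
    map val (mkseq (fun i => t i.+1) (size q)) by rewrite /mkseq -map_comp.
apply/seteqP; split=> t; rewrite /initial /= size_map E.
  exact: (seq.inj_map val_inj).
by move=> ->.
Qed.

Lemma inclusion_future n B : future_events young n B ->
  future_events Y n (incl @^-1` B).
Proof.
move=> FB; pose X := g_sigma_algebraType (coord_events Y n).
pose X' := g_sigma_algebraType (coord_events young n).
have : measurable_fun (setT : set X) (incl : X -> X').
  apply: (@measurability _ _ X X' setT incl (coord_events young n) erefl).
  move=> _ [_ [m nm [C _ <-]] <-]; rewrite !setTI.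
  by apply: sub_sigma_algebra; exists m => //; exists (val @^-1` C);
    rewrite ?setTI.
by move=> /(_ measurableT B FB); rewrite setTI.
Qed.

Lemma central_inclusion (R : realType) (P : probability (path_space Y) R) :
  central P -> central (distribution P incl).
Proof.
move=> cP; apply: central_initialP => la p B pla FB.
suff : (pathdim la)%:R * fine (P (incl @^-1` (initial p `&` B))) =
  fine (P (incl @^-1` (cylinder la `&` B))) by [].
have [lak|kla] := leqP (size (rows la)) k.
  pose v : Y := exist _ la lak.
  have [q qv qp] := @finpaths_lift v p pla.
  rewrite -[la]/(val v) !preimage_setI -qp inclusion_initial.
  rewrite inclusion_cylinder pathdim_val.
  by rewrite (central_initial cP) //; exact: inclusion_future.
have H A : A `<=` cylinder la -> P (incl @^-1` A) = 0%E.
  move=> AC; suff -> : incl @^-1` A = set0 by rewrite measure0.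
  by rewrite -subset0 -(inclusion_cylinder0 kla) => t; exact: AC.
by rewrite !H ?mulr0 // => t [] // /(initial_cylinder pla).
Qed.

End YoungRowsEmbedding.

(** By compactness, a sequence in [0, 1] converges along every ultrafilter. *)
Lemma ultra_cvg01 (R : realType) (U : set_system nat) (u : nat -> R) :
  UltraFilter U -> (forall n, 0 <= u n <= 1) -> exists l : R, u @ U --> l.
Proof.
move=> UU u01; have [|l [_ lU]] := @segment_compact R 0 1 (u @ U) _.
  suff : U (u @^-1` `[0, 1]%classic) by [].
  by apply: filterE => n /=; rewrite in_itv /= u01.
exists l => A lA; have [//|UA] := in_ultra_setVsetC (u @^-1` A) UU.
by have [y [nAy Ay]] := lU (~` A) A UA lA.
Qed.

(** * Ergodic central measures on diagrams with at most k rows *)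

Theorem theorem2 (R : realType) (k : nat) (k_gt0 : (0 < k)%N)
    (P : probability (path_space (young_rows k_gt0)) R) :
  central P -> ergodic P ->
  exists p : 'I_k -> R,
    [/\ forall i j : 'I_k, (i <= j)%N -> p j <= p i,
        forall i : 'I_k, 0 <= p i,
        \sum_(i < k) p i = 1 &
        thoma p (distribution P (@young_rows_inclusion k k_gt0))].
Proof.
move=> cP eP; pose Y := young_rows k_gt0.
(* Vertices w J of level n J > J whose conditional probabilities of passages
   tend to the probabilities of these passages. *)
pose vs J : seq Y := pmap choice.unpickle (iota 0 J).
have /choice[w wP] (J : nat) : exists w : Y, [/\ (J.+1 <= level w)%N,
    fine (P (cylinder w)) != 0 & forall v, v \in vs J ->
    `|cprob P v w - fine (P (cylinder v))| <= J.+1%:R^-1].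
  by apply: cprob_approx => //; rewrite invr_gt0 ltr0n.
pose n J := level (w J).
have Jn J : (J < n J)%N by have [] := wP J.
have n0 J : 0 < (n J)%:R :> R by rewrite ltr0n (leq_ltn_trans _ (Jn J)).
(* Along an ultrafilter all the row lengths converge after division by the
   level. *)
have [U [UU ooU]] := @ultraFilterLemma nat \oo _.
have invJ : (fun J => J.+1%:R^-1 : R) @ U --> 0.
  by apply: cvg_trans (@cvg_harmonic R) => A; exact: ooU.
have squeeze0 (f : nat -> R) :
    (forall J, 0 <= f J <= J.+1%:R^-1) -> f @ U --> 0.
  move=> fJ; apply: (squeeze_cvgr _ (cvg_cst 0) invJ).
  exact: filterE.
have invn : (fun J => (n J)%:R^-1 : R) @ U --> 0.
  apply: squeeze0 => J; rewrite invr_ge0 ler0n /=.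
  by rewrite lef_pV2 ?posrE ?n0 ?ltr0n ?ler_nat.
have sumrow J : \sum_(i < k) (rowlen (w J) i)%:R / (n J)%:R = 1 :> R.
  by rewrite -mulr_suml -natr_sum -level_row mulfV // (gt_eqF (n0 J)).
have /choice[q qP] (i : nat) : exists l : R,
    (fun J => (rowlen (w J) i)%:R / (n J)%:R) @ U --> l.
  apply: ultra_cvg01 => J; rewrite divr_ge0 //= ler_pdivrMr // mul1r ler_nat.
  have [ik|ik] := ltnP i k; last by rewrite row_ge.
  by rewrite /n level_row (bigD1 (Ordinal ik)) //= leq_addr.
pose p (i : 'I_k) := q i.
have limU (f : nat -> R) (a b : R) : f @ U --> a -> f @ U --> b -> a = b.
  by move=> fa fb; exact: (cvg_unique _ fa fb).
exists p; split.
- move=> i j ij; apply: (ler_cvg_to (qP j) (qP i)); apply: filterE => J.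
  by rewrite ler_pM2r ?invr_gt0 // ler_nat diagram_nonincrW.
- move=> i; apply: (ler_cvg_to (cvg_cst 0) (qP i)); apply: filterE => J.
  by rewrite divr_ge0.
- apply: (limU (cst 1)); last exact: cvg_cst.
  rewrite (_ : cst 1 = fun J => \sum_(i < k) (rowlen (w J) i)%:R / (n J)%:R).
    by apply: cvg_bigsum => i _; exact: qP.
  by apply/funext => J; rewrite sumrow.
split; first exact: central_inclusion.
move=> la; suff : P (@young_rows_inclusion k k_gt0 @^-1` cylinder la) =
  ((pathdim la)%:R * schur la p)%:E by [].
have [lak|kla] := leqP (size (rows la)) k; last first.
  by rewrite inclusion_cylinder0 // measure0 schur_eq0 // mulr0.
pose v : Y := exist _ la lak.
rewrite -[la]/(val v) inclusion_cylinder pathdim_val.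
rewrite -prE; last exact: measurable_cylinder.
congr _%:E; set c := fine _.
pose N := (level v).+1.
have srowq i : (i < k)%N -> (fun J => (srow (w J) i)%:R / (n J)%:R) @ U --> q i.
  move=> ik; rewrite -[q i]addr0 -[X in _ + X](mulr0 (k - i.+1)%:R).
  rewrite (_ : (fun J => _) = fun J => (rowlen (w J) i)%:R / (n J)%:R +
      (k - i.+1)%:R * (n J)%:R^-1); last first.
    by apply/funext => J; rewrite /srow natrD mulrDl.
  by apply: cvgD; [exact: qP|apply: cvgM => //; exact: cvg_cst].
have vN j : (nth 0 la j < N)%N.
  have [jk|jk] := ltnP j k; first exact: (shape_row (ltnSn (level v))).2 _ jk.
  by rewrite -[nth _ _ _]/(rowlen v j) row_ge.
rewrite (@schur_fschur_gt0 k N la R p q) //.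
(* Both sides of the identity of npath_fschur for w J are passed to the limit;
   at th = 0 the normalizing factor is 1. *)
pose m := level v.
have lim1 : (fun J => (pathdim v)%:R * fschur N (n J)%:R^-1 k (rowlen v)
    (fun i => (srow (w J) i)%:R / (n J)%:R)) @ U -->
    (pathdim v)%:R * fschur N 0 k (rowlen v) q.
  by apply: cvgM; [exact: cvg_cst|apply: cvg_fschur].
have cpc : (fun J => cprob P v (w J)) @ U --> c.
  apply/cvgrPdist_le => e e0.
  have /cvgrPdist_le/(_ _ e0) H := invJ.
  have Hv : U [set J | (choice.pickle v < J)%N] by apply: ooU;
    exact: nbhs_infty_gt.
  apply: filterS2 H Hv => J; rewrite sub0r normrN ger0_norm ?invr_ge0 //.
  move=> He vJ.
  apply: le_trans He; rewrite distrC; have [_ _] := wP J; apply.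
  rewrite mem_pmap; apply/mapP; exists (choice.pickle v);
    last by rewrite choice.pickleK.
  by rewrite mem_iota.
have ff1 : ffpow 0 m 1 = 1 :> R.
  by rewrite /ffpow big1 // => s _; rewrite mulr0 subr0.
have lim2 : (fun J => cprob P v (w J) * ffpow (n J)%:R^-1 m 1) @ U --> c.
  have := cvgM cpc (cvg_ffpow (a := m) invn (@cvg_cst _ (1 : R) _ U _)).
  by rewrite ff1 mulr1; apply.
apply: (limU _ _ _ lim2); apply: cvg_trans lim1; apply: near_eq_cvg.
have Hm : U [set J | (m <= J)%N] by apply: ooU; exact: nbhs_infty_ge.
apply: filterS Hm => J mJ.
have vn : (level v <= n J)%N by exact: leq_trans mJ (ltnW (Jn J)).
have [_ wn0 _] := wP J.
rewrite (@cprob_npath _ _ _ cP (n J - level v)) ?subnKC // -mulrA;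
  congr (_ * _).
by rewrite -npath_fschur // (leq_ltn_trans _ (Jn J)).
Qed.
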